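(* Let $(\theta,M,h,N)$ be one of Dwork's Kummer transformation data for the hypergeometric system (as described in the context), and put $H(\vec a,\lambda)=h(\vec a,\lambda)N(\lambda)$. Let $\vec a,\vec b\in\mathbb{Z}_p^3$ with $p\vec b-\vec a\in\mathbb{Z}^3$. Let $\lambda\mapsto\phi(\lambda)$ be a function analytic in a region of the type $$\inf\{|\lambda|,|\lambda^{-1}|,|1-\lambda|\}>1-\epsilon$$ for some $\epsilon>0$, and close to Frobenius in the sense that $|\phi(\lambda)-\lambda^p|<1$ for every $\lambda$ with $|\lambda|=1=|1-\lambda|$. Then $$H(\vec a,\lambda)\,\gamma\bigl(M(\vec a),M(\vec b);\theta(\lambda),\theta(\phi(\lambda))\bigr)=\gamma\bigl(\vec a,\vec b;\lambda,\phi(\lambda)\bigr)\,H^{\sigma}(\vec b,\phi(\lambda)).$$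
   Context: **Hypergeometric system.** $p$ is an odd prime. For $\vec a=(a_1,a_2,a_3)\in\mathbb{Z}_p^3$ consider $\frac{dY}{d\lambda}=Y\,G_{\vec a}(\lambda)$ with $$G_{\vec a}(\lambda)=\begin{pmatrix}-\frac{a_3}{\lambda}&\frac{a_3-a_1}{1-\lambda}\\ \frac{a_3-a_2}{\lambda}&\frac{a_1+a_2-a_3}{1-\lambda}\end{pmatrix}.$$ $C_{\vec a}(z,\lambda)$ denotes the solution matrix at $z\neq0,1,\infty$ with $C_{\vec a}(z,z)=I_2$; for $|z|=|1-z|=1$ it converges for $|\lambda-z|<1$. The parameters are assumed generic: none of $a_1,a_2,a_3,a_3-a_1,a_3-a_2,a_1-a_2,a_1+a_2-a_3$ is an integer, and the matrices $U^{(0)}$ below converge for $|\lambda|<1$. **Frobenius matrix.** For $p\vec b-\vec a=\vec\mu\in\mathbb{Z}^3$, Dwork's Frobenius matrix $\gamma(\vec a,\vec b;\lambda)$ (for the lifting $\lambda\mapsto\lambda^p$) is the matrix of $p$-adic meromorphic functions, with poles at most at the singular points, defined on $\mathbb{P}^1$ minus two closed disks of radius $<1$ around $1$ and $\infty$, and characterized for $|\lambda|<1$ by $$U^{(0)}_{\vec b}(\lambda^p)\,\gamma(\vec a,\vec b;\lambda)^t=\begin{pmatrix}\xi_1^{(0)}&0\\0&\xi_2^{(0)}\lambda^{\mu_3}\end{pmatrix}U^{(0)}_{\vec a}(\lambda)$$ (the existence of this continuation is a known theorem of Dwork). Here $\begin{pmatrix}1&0\\0&\lambda^{-a_3}\end{pmatrix}U^{(0)}_{\vec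 a}(\lambda)$ is the solution matrix with $U^{(0)}_{\vec a}$ holomorphic at $0$ and $U_{\vec a}^{(0)}(0)=\begin{pmatrix}a_3-a_2&a_3\\1-a_3&0\end{pmatrix}$, and $$\xi_1^{(0)}=\frac{\gamma_p(a_2,b_2)\gamma_p(a_3-a_2,b_3-b_2)}{\gamma_p(1+a_3,1+b_3)},\quad \xi_2^{(0)}=(-1)^{\mu_2-\mu_3}\frac{\gamma_p(a_3-1,b_3-1)\gamma_p(1-a_1,1-b_1)}{\gamma_p(1+a_3-a_1,1+b_3-b_1)},$$ where, with fixed $\pi$, $\pi^{p-1}=-p$, the symbol $\gamma_p(x,y)$ (for $py-x=\mu\in\mathbb{Z}$) is determined by $\gamma_p(x,y)=\pi^\mu\Gamma_p(x)$ if $0\le\mu\le p-1$ ($\Gamma_p$ Morita's gamma function), and $\gamma_p(x+m,y+n)=(-\pi)^{n-m}\frac{\Gamma(x+m)\Gamma(y)}{\Gamma(x)\Gamma(y+n)}\gamma_p(x,y)$ for $m,n\in\mathbb{Z}$ (Gamma ratios being the rational functions given by $\Gamma(t+1)=t\Gamma(t)$). It satisfies $C_{\vec b}(z^p,\lambda^p)\gamma(\vec a,\vec b;\lambda)^t=\gamma(\vec a,\vec b;z)^tC_{\vec a}(z,\lambda)$. The two-variable matrix is $$\gamma(\vec a,\vec b;x,y)=\gamma(\vec a,\vec b;x)\,C_{\vec b}(y,x^p)^t,\qquad |x|=|1-x|=1,\ |y-x^p|<1,$$ so that $\gamma(\vec a,\vec b;x,x^p)=\gamma(\vec a,\vec b;x)$;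 for a lifting $\phi$ of Frobenius one writes $\gamma^{(\phi)}(\vec a,\vec b;\lambda)=\gamma(\vec a,\vec b;\lambda,\phi(\lambda))$. The asserted identity holds for $|\lambda|=|1-\lambda|=1$, and elsewhere by analytic continuation. **Kummer transformation data.** In each datum, $\theta$ is one of the six Möbius transformations permuting $\{0,1,\infty\}$, $M$ is an affine-linear map of the parameters with integer coefficients, $N(\lambda)$ is an invertible $2\times2$ matrix of rational functions of $\lambda$ with coefficients in $\mathbb{Q}$, regular and invertible away from $0,1,\infty$ and for $|\lambda|=|1-\lambda|=1$, and $h(\vec a,\lambda)=(-1)^{t(\vec a)}\lambda^{r(\vec a)}(1-\lambda)^{s(\vec a)}$ with $t,r,s$ affine-linear with integer coefficients. Examples: - $\theta=\lambda^{-1}$, $M(\vec a)=(a_1,a_1-a_3,a_1-a_2)$, $h=(-1)^{a_3-a_1-a_2}\lambda^{-a_1}$, $N=\begin{pmatrix}1&0\\1&-1\end{pmatrix}$; - $\theta=1-\lambda$, $M(\vec a)=(a_1,a_2,a_1+a_2-a_3)$, $h=(-1)^{a_2}$, $N=\begin{pmatrix}0&1\\1&0\end{pmatrix}$; - $\theta=(1-\lambda)^{-1}$, $M(\vec a)=(a_1,a_3-a_2,a_1-a_2)$, $h=(-1)^{a_3-a_2}(1-\lambda)^{-a_1}$, $N=\begin{pmatrix}1&-1\\1&0\end{pmatrix}$. Only the quotient of the factors $h$ on the two sides is meaningful: $h(\vec a,\lambda)/h^\sigma(\vec b,y)$ means $$(-1)^{t(\vec a)-p\,t(\vec b)}\,\lambda^{r(\vec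 a)-p\,r(\vec b)}\Bigl(\tfrac{y}{\lambda^p}\Bigr)^{-r(\vec b)}(1-\lambda)^{s(\vec a)-p\,s(\vec b)}\Bigl(\tfrac{1-y}{(1-\lambda)^p}\Bigr)^{-s(\vec b)}$$ for $|y-\lambda^p|<1$, with binomial series; so the asserted identity means $\frac{h(\vec a,\lambda)}{h^\sigma(\vec b,\phi(\lambda))}N(\lambda)\gamma(M(\vec a),M(\vec b);\theta(\lambda),\theta(\phi(\lambda)))=\gamma(\vec a,\vec b;\lambda,\phi(\lambda))N(\phi(\lambda))$. The following facts about these data are known (Dwork, *On Kummer's twenty-four solutions of the hypergeometric differential equation* ) and characterize what is used about them: (K1) for $|x|=|1-x|=1$, $|y-x|<1$: $\ C_{M(\vec a)}(\theta(x),\theta(y))\,H(\vec a,y)^t=H(\vec a,x)^t\,C_{\vec a}(x,y)$ (where the ratio $h(\vec a,y)/h(\vec a,x)$ is $(y/x)^{r(\vec a)}((1-y)/(1-x))^{s(\vec a)}$); (K2) for the standard Frobenius: $\ H(\vec a,\lambda)\,\gamma(M(\vec a),M(\vec b);\theta(\lambda),\theta(\lambda^p))=\gamma(\vec a,\vec b;\lambda,\lambda^p)\,H^\sigma(\vec b,\lambda^p)$. *)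

(* Defs.v *)
From HB Require Import structures.
From mathcomp Require Import all_boot all_order all_algebra.
From mathcomp Require Import all_classical reals topology normedtype sequences.

Set Implicit Arguments.
Unset Strict Implicit.
Unset Printing Implicit Defensive.

Import Order.TTheory GRing.Theory Num.Theory.
Import numFieldNormedType.Exports.

Local Open Scope classical_set_scope.
Local Open Scope ring_scope.

(* [v] makes K a complete extension of Q_p, with |p| = 1/p.  For an
   algebraically closed K this covers C_p and Dwork's larger universal
   domains. *)
Record padic_abs (R : realType) (K : fieldType) (p : nat) (v : K -> R) : Prop :=
  PadicAbs {
    abs_ge0 : forall x, 0 <= v x;
    abs_eq0 : forall x, (v x == 0) = (x == 0);
    absM : forall x y, v (x * y) = v x * v y;
    abs_ultra : forall x y, v (x + y) <= Num.max (v x) (v y);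
    abs_p : v p%:R = p%:R^-1;
    abs_complete : forall u : nat -> K,
      (forall e, 0 < e -> exists N : nat, forall m n : nat,
         (N <= m)%N -> (N <= n)%N -> v (u m - u n) < e) ->
      exists l, v (u n - l) @[n --> \oo] --> (0 : R) }.

Section MatrixNotation.
Context {K : fieldType}.

Definition mx2 (x11 x12 x21 x22 : K) : 'M[K]_2 :=
  \matrix_(i < 2, j < 2)
    if i == 0 then (if j == 0 then x11 else x12)
    else (if j == 0 then x21 else x22).

Definition pa1 (a : 'rV[K]_3) : K := a 0 0.
Definition pa2 (a : 'rV[K]_3) : K := a 0 1.
Definition pa3 (a : 'rV[K]_3) : K := a 0 2.

Definition isint (x : K) : Prop := exists m : int, x = m%:~R.

(* The integer equal to x, when there is one (it is unique in
   characteristic 0). *)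
Definition intval (x : K) : int := xget 0 [set m : int | x = m%:~R].

Definition Gmx (a : 'rV[K]_3) (l : K) : 'M[K]_2 :=
  mx2 (- (pa3 a / l))          ((pa3 a - pa1 a) / (1 - l))
      ((pa3 a - pa2 a) / l)    ((pa1 a + pa2 a - pa3 a) / (1 - l)).

Definition binom (s : K) (n : nat) : K :=
  (\prod_(i < n) (s - i%:R)) / n`!%:R.

(* Gamma(x + m) / Gamma(x) *)
Definition gamma_ratio (x : K) (m : int) : K :=
  match m with
  | Posz n => \prod_(i < n) (x + i%:R)
  | Negz n => (\prod_(i < n.+1) (x - i.+1%:R))^-1
  end.

(* The six Moebius transformations permuting {0, 1, oo}. *)
Inductive anharmonic :=
  | An_id | An_1sub | An_inv | An_inv1sub | An_div | An_1subinv.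

Definition anh (t : anharmonic) (l : K) : K :=
  match t with
  | An_id => l
  | An_1sub => 1 - l
  | An_inv => l^-1
  | An_inv1sub => (1 - l)^-1
  | An_div => l / (l - 1)
  | An_1subinv => (l - 1) / l
  end.

(* Affine-linear forms and maps of the parameters, with integer coefficients. *)
Record aform := AForm { af_cst : int; af_lin : 'cV[int]_3 }.

Definition aeval (f : aform) (a : 'rV[K]_3) : K :=
  (a *m map_mx intr (af_lin f)) 0 0 + (af_cst f)%:~R.

Record amap := AMap { am_cst : 'rV[int]_3; am_lin : 'M[int]_3 }.

Definition mapply (M : amap) (a : 'rV[K]_3) : 'rV[K]_3 :=
  a *m map_mx intr (am_lin M) + map_mx intr (am_cst M).

(* The matrix N of rational functions over Q is kd_num / kd_den; the factor h
   is (-1)^t * l^r * (1 - l)^s. *)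
Record kummer_datum := KummerDatum {
  kd_theta : anharmonic;
  kd_M : amap;
  kd_t : aform;
  kd_r : aform;
  kd_s : aform;
  kd_num : 'M[{poly rat}]_2;
  kd_den : {poly rat} }.

Definition kd_N (D : kummer_datum) (l : K) : 'M[K]_2 :=
  \matrix_(i < 2, j < 2)
    ((map_poly ratr (kd_num D i j)).[l] / (map_poly ratr (kd_den D)).[l]).

End MatrixNotation.

Section Padic.
Context {R : realType} {K : fieldType} (p : nat) (v : K -> R) (pi : K).

Definition vsum (f : nat -> K) : K :=
  xget 0 [set l | v (\sum_(k < n) f k - l) @[n --> \oo] --> (0 : R)].

Definition mxsum_cvg (f : nat -> 'M[K]_2) (L : 'M[K]_2) : Prop :=
  forall i j, v ((\sum_(k < n) f k - L) i j) @[n --> \oo] --> (0 : R).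

(* u ^ s for |u - 1| < 1 and s in Z_p *)
Definition binpow (u s : K) : K := vsum (fun n => binom s n * (u - 1) ^+ n).

(* Z_p, as the closure of the natural numbers in K *)
Definition Zp : set K :=
  [set x | forall e : R, 0 < e -> exists n : nat, v (x - n%:R) < e].

Definition unit_region : set K := [set x | v x = 1 /\ v (1 - x) = 1].

Definition eps_region (eps : R) : set K :=
  [set x | 1 - eps < Num.min (v x) (Num.min (v x^-1) (v (1 - x)))].

(* Analytic functions in the sense of Krasner: uniform limits of rational
   functions without poles in D. *)
Definition analytic_on (D : set K) (f : K -> K) : Prop :=
  forall e : R, 0 < e -> exists P Q : {poly K},
    forall x, D x -> Q.[x] != 0 /\ v (f x - P.[x] / Q.[x]) < e.

Definition mx_analytic_on (D : set K) (F : K -> 'M[K]_2) : Prop :=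
  forall i j, analytic_on D (fun x => F x i j).

(* On the disk |l - z| < 1, Y is the sum of a power series in l - z and dY is
   its derivative. *)
Definition disk_derivative (z : K) (Y dY : K -> 'M[K]_2) : Prop :=
  exists c : nat -> 'M[K]_2, forall l, v (l - z) < 1 ->
    mxsum_cvg (fun n => (l - z) ^+ n *: c n) (Y l) /\
    mxsum_cvg (fun n => (l - z) ^+ n *: (n.+1%:R *: c n.+1)) (dY l).

Definition solution_matrix (a : 'rV[K]_3) (z : K) (Y : K -> 'M[K]_2) : Prop :=
  Y z = 1%:M /\ disk_derivative z Y (fun l => Y l *m Gmx a l).

Definition Csol (a : 'rV[K]_3) (z : K) : K -> 'M[K]_2 :=
  xget (fun=> 0) [set Y | solution_matrix a z Y].

(* The equation satisfied by U when diag(1, l^(-a3)) U is a solution matrix,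
   after removing the factor diag(1, l^(-a3)). *)
Definition is_U0 (a : 'rV[K]_3) (U : K -> 'M[K]_2) : Prop :=
  U 0 = mx2 (pa3 a - pa2 a) (pa3 a) (1 - pa3 a) 0 /\
  exists2 dU, disk_derivative 0 U dU &
    forall l, 0 < v l < 1 ->
      dU l = mx2 0 0 0 (pa3 a / l) *m U l + U l *m Gmx a l.

Definition U0 (a : 'rV[K]_3) : K -> 'M[K]_2 :=
  xget (fun=> 0) [set U | is_U0 a U].

Definition generic (a : 'rV[K]_3) : Prop :=
  [/\ forall i, Zp (a 0 i),
      [/\ ~ isint (pa1 a), ~ isint (pa2 a) & ~ isint (pa3 a)],
      [/\ ~ isint (pa3 a - pa1 a), ~ isint (pa3 a - pa2 a),
          ~ isint (pa1 a - pa2 a) & ~ isint (pa1 a + pa2 a - pa3 a)]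
    & exists U, is_U0 a U].

(* Morita's gamma function (p odd): continuous on Z_p, and equal at n >= 2 to
   (-1)^n times the product of the j < n prime to p. *)
Definition is_morita (g : K -> K) : Prop :=
  (forall n : nat, (2 <= n)%N ->
     g n%:R = (-1) ^+ n * \prod_(1 <= j < n | ~~ (p %| j)%N) j%:R) /\
  (forall x, Zp x -> forall e : R, 0 < e -> exists2 d : R, 0 < d &
     forall y, Zp y -> v (y - x) < d -> v (g y - g x) < e).

Definition Gammap : K -> K := xget (fun=> 0) [set g | is_morita g].

(* Non-integral x keeps the Gamma ratios away from zeros and poles. *)
Definition is_dwork_gamma (g : K -> K -> K) : Prop :=
  (forall x y (mu : nat), Zp x -> Zp y -> ~ isint x -> (mu <= p.-1)%N ->
     p%:R * y - x = mu%:R -> g x y = pi ^+ mu * Gammap x) /\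
  (forall x y (m n : int), Zp x -> Zp y -> ~ isint x -> isint (p%:R * y - x) ->
     g (x + m%:~R) (y + n%:~R) =
       (- pi) ^ (n - m) * (gamma_ratio x m / gamma_ratio y n) * g x y).

Definition gammap : K -> K -> K := xget (fun _ _ => 0) [set g | is_dwork_gamma g].

Definition xi1 (a b : 'rV[K]_3) : K :=
  gammap (pa2 a) (pa2 b) * gammap (pa3 a - pa2 a) (pa3 b - pa2 b)
  / gammap (1 + pa3 a) (1 + pa3 b).

Definition xi2 (a b : 'rV[K]_3) (mu : 'rV[int]_3) : K :=
  (-1) ^ (mu 0 1 - mu 0 2)
  * (gammap (pa3 a - 1) (pa3 b - 1) * gammap (1 - pa1 a) (1 - pa1 b)
     / gammap (1 + pa3 a - pa1 a) (1 + pa3 b - pa1 b)).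

(* P^1 minus the closed disks of radius rho around 1 and oo *)
Definition frob_region (rho : R) : set K :=
  [set x | rho < v (x - 1) /\ rho * v x < 1].

(* The only singular point in [frob_region rho] is 0: [g] is meromorphic there
   with a pole at most at 0, hence 0 is excluded from the defining relation. *)
Definition is_frobenius (a b : 'rV[K]_3) (g : K -> 'M[K]_2) : Prop :=
  (exists (rho : R) (m : nat) (F : K -> 'M[K]_2),
     [/\ 0 < rho < 1, mx_analytic_on (frob_region rho) F
       & forall l, frob_region rho l -> l != 0 -> F l = l ^+ m *: g l]) /\
  (exists mu : 'rV[int]_3, p%:R *: b - a = map_mx intr mu /\
     forall l, 0 < v l < 1 ->
       U0 b (l ^+ p) *m (g l)^T =
       mx2 (xi1 a b) 0 0 (xi2 a b mu * l ^ (mu 0 2)) *m U0 a l).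

Definition frobenius (a b : 'rV[K]_3) : K -> 'M[K]_2 :=
  xget (fun=> 0) [set g | is_frobenius a b g].

Definition frobenius2 (a b : 'rV[K]_3) (x y : K) : 'M[K]_2 :=
  frobenius a b x *m (Csol b y (x ^+ p))^T.

(* h(a, l) / h^sigma(b, y), for |y - l^p| < 1 *)
Definition hquot (D : kummer_datum) (a b : 'rV[K]_3) (l y : K) : K :=
  (-1) ^ intval (aeval (kd_t D) a - p%:R * aeval (kd_t D) b)
  * l ^ intval (aeval (kd_r D) a - p%:R * aeval (kd_r D) b)
  * binpow (y / l ^+ p) (- aeval (kd_r D) b)
  * (1 - l) ^ intval (aeval (kd_s D) a - p%:R * aeval (kd_s D) b)
  * binpow ((1 - y) / (1 - l) ^+ p) (- aeval (kd_s D) b).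

(* h(a, y) / h(a, x), for |y - x| < 1 *)
Definition hratio (D : kummer_datum) (a : 'rV[K]_3) (x y : K) : K :=
  binpow (y / x) (aeval (kd_r D) a)
  * binpow ((1 - y) / (1 - x)) (aeval (kd_s D) a).

(* H(a, l) X = Y H^sigma(b, y), with the quotient of the factors h on the left *)
Definition H_intertwines (D : kummer_datum) (a b : 'rV[K]_3) (l y : K)
    (X Y : 'M[K]_2) : Prop :=
  hquot D a b l y *: (kd_N D l *m X) = Y *m kd_N D y.

Definition is_kummer (D : kummer_datum) : Prop :=
  let M := mapply (kd_M D) in
  let theta := anh (kd_theta D) in
  [/\ forall l : K, l != 0 -> l != 1 ->
        (map_poly ratr (kd_den D)).[l] != 0 /\ kd_N D l \in unitmx,
      forall a, generic a -> generic (M a) ->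
        forall x y, unit_region x -> v (y - x) < 1 ->
          hratio D a x y *: (Csol (M a) (theta x) (theta y) *m (kd_N D y)^T) =
          (kd_N D x)^T *m Csol a x y
    & forall a b, generic a -> generic b -> generic (M a) -> generic (M b) ->
        (forall i, isint (p%:R * b 0 i - a 0 i)) ->
        forall l, unit_region l ->
          H_intertwines D a b l (l ^+ p)
            (frobenius2 (M a) (M b) (theta l) (theta (l ^+ p)))
            (frobenius2 a b l (l ^+ p))].

End Padic.

(* Main.v *)
Require Import Defs.
From HB Require Import structures.
From mathcomp Require Import all_boot all_order all_algebra.
From mathcomp Require Import all_classical reals topology normedtype sequences.
From mathcomp Require Import ring.

Set Implicit Arguments.
Unset Strict Implicit.
Unset Printing Implicit Defensive.

Import Order.TTheory GRing.Theory Num.Theory.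
Import numFieldNormedType.Exports.

Local Open Scope classical_set_scope.
Local Open Scope ring_scope.

(** Write w = l ^ p and y = phi(l).  By definition the two-variable Frobenius
    matrix at (l, y) is the one-variable matrix at l times the transpose of the
    solution matrix from y to w.  The transformation law of the solution matrices
    between y and w, followed by the Kummer identity for the standard lifting w,
    turns gamma(a, b; l, y) N(y) into a scalar multiple of N(l) times the Frobenius
    matrix of (M(a), M(b)) at theta(l), times the transposes of the solution
    matrices from theta(w) to theta(l) ^ p and from theta(y) to theta(w).  These
    compose to the solution matrix from theta(y) to theta(l) ^ p ([Csol_mul]),
    because the three points lie in one residue disk: theta is a composite of the
    substitutions 1 - l and 1 / l, which reduce modulo the maximal ideal and
    commute there with Frobenius ([anh_frob_compatible]).  Composition itself is
    Taylor re-expansion at another point of the disk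
    ([disk_derivative_recentre]) and uniqueness for linear differential equations
    ([linear_ode_zero]).  The scalars agree since the binomial series for u ^ s,
    with u close to 1 and s in Z_p, is multiplicative in u and turns sums of
    exponents into products ([binpowMl], [binpowD], [binpow_change]); both follow
    from natural exponents by continuity ([binpow_approx]).

    The identity then extends from |l| = |1 - l| = 1 to the eps-region because
    a Krasner analytic function on that region is determined by its values on the
    unit region ([analytic_eq0]).  Each remaining point lies in an annulus around
    0, 1 or infinity bordering the unit region.  Factoring numerator and
    denominator over the algebraically closed field K gives Hadamard's
    three-circles inequality for rational functions without poles in the annulus;
    approximants that are small on the unit region and bounded on the far circle
    are therefore small in between ([analytic_eq0_annulus]). *)

(** * Absolute values *)

Section PadicAbs.
Context {R : realType} {K : fieldType} {p : nat} {v : K -> R}.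
Context (p_prime : prime p) (v_padic : padic_abs p v).

Lemma v_ge0 x : 0 <= v x.
Proof. exact: (abs_ge0 v_padic). Qed.

Lemma v_eq0 x : (v x == 0) = (x == 0).
Proof. exact: (abs_eq0 v_padic). Qed.

Lemma v_gt0 x : (0 < v x) = (x != 0).
Proof. by rewrite lt_def v_eq0 v_ge0 andbT. Qed.

Lemma v0 : v 0 = 0.
Proof. by apply/eqP; rewrite v_eq0. Qed.

Lemma vM x y : v (x * y) = v x * v y.
Proof. exact: (absM v_padic). Qed.

Lemma v1 : v 1 = 1.
Proof.
have nz : v 1 != 0 by rewrite v_eq0 oner_eq0.
by apply: (mulfI nz); rewrite -vM !mulr1.
Qed.

Lemma vX x n : v (x ^+ n) = v x ^+ n.
Proof. by elim: n => [|n IH]; rewrite ?expr0 ?v1 // !exprS vM IH. Qed.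

Lemma vN x : v (- x) = v x.
Proof.
have: v (-1) ^+ 2 = 1 by rewrite -vX sqrrN expr1n v1.
move/eqP; rewrite sqrf_eq1 => /orP[/eqP vm1|/eqP vm1].
  by rewrite -mulN1r vM vm1 mul1r.
by have := v_ge0 (-1); rewrite vm1 ler0N1.
Qed.

Lemma v_sub x y : v (x - y) = v (y - x).
Proof. by rewrite -vN opprB. Qed.

Lemma vV x : v x^-1 = (v x)^-1.
Proof.
have [->|x0] := eqVneq x 0; first by rewrite invr0 v0 invr0.
have vx0 : v x != 0 by rewrite v_eq0.
by apply: (mulfI vx0); rewrite -vM !divff ?v1.
Qed.

Lemma v_prod I (r : seq I) (F : I -> K) :
  v (\prod_(i <- r) F i) = \prod_(i <- r) v (F i).
Proof. by apply: (big_morph v vM v1). Qed.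

Lemma vD_le x y e : v x <= e -> v y <= e -> v (x + y) <= e.
Proof.
by move=> hx hy; rewrite (le_trans (abs_ultra v_padic x y)) // ge_max hx hy.
Qed.

Lemma vD_lt x y e : v x < e -> v y < e -> v (x + y) < e.
Proof.
by move=> hx hy; rewrite (le_lt_trans (abs_ultra v_padic x y)) // gt_max hx hy.
Qed.

Lemma vB_le x y e : v x <= e -> v y <= e -> v (x - y) <= e.
Proof. by move=> hx hy; apply: vD_le => //; rewrite vN. Qed.

Lemma vB_lt x y e : v x < e -> v y < e -> v (x - y) < e.
Proof. by move=> hx hy; apply: vD_lt => //; rewrite vN. Qed.

Lemma v_dist_le y x z e : v (x - y) <= e -> v (y - z) <= e -> v (x - z) <= e.
Proof. by move=> hx hy; rewrite -(subrKA y); apply: vD_le. Qed.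

Lemma v_dist_lt y x z e : v (x - y) < e -> v (y - z) < e -> v (x - z) < e.
Proof. by move=> hx hy; rewrite -(subrKA y); apply: vD_lt. Qed.

(** Isosceles triangles: the larger of two distinct absolute values wins. *)
Lemma vD_max x y : v x < v y -> v (x + y) = v y.
Proof.
move=> xy; apply/eqP; rewrite eq_le (vD_le (ltW xy)) //= leNgt; apply/negP => h.
by have := vB_lt h xy; rewrite addrC addKr ltxx.
Qed.

Lemma v_close x y e : v (x - y) < e -> v y = e -> v x = e.
Proof. by move=> h ye; rewrite -(subrK y x) vD_max ye. Qed.

Lemma v_sum_le I (r : seq I) (P : pred I) (F : I -> K) e :
  0 <= e -> (forall i, P i -> v (F i) <= e) -> v (\sum_(i <- r | P i) F i) <= e.
Proof.
move=> e0 h; elim/big_ind: _ => //; first by rewrite v0.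
by move=> *; apply: vD_le.
Qed.

Lemma v_sum_lt I (r : seq I) (P : pred I) (F : I -> K) e :
  0 < e -> (forall i, P i -> v (F i) < e) -> v (\sum_(i <- r | P i) F i) < e.
Proof.
move=> e0 h; elim/big_ind: _ => //; first by rewrite v0.
by move=> *; apply: vD_lt.
Qed.

Lemma v_nat_le1 n : v n%:R <= 1.
Proof.
elim: n => [|n IH]; first by rewrite v0.
by rewrite -addn1 natrD vD_le // v1.
Qed.

Lemma vp_gt0 : 0 < v p%:R.
Proof. by rewrite (abs_p v_padic) invr_gt0 ltr0n prime_gt0. Qed.

Lemma vp_lt1 : v p%:R < 1.
Proof.
rewrite (abs_p v_padic) invf_lt1 ?ltr0n ?prime_gt0 //.
by rewrite ltr1n prime_gt1.
Qed.

Lemma p_neq0 : p%:R != 0 :> K.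
Proof. by rewrite -v_gt0 vp_gt0. Qed.

(** The residue characteristic p is not zero in K, and an integer prime to p is
    a unit by Bezout; so K has characteristic 0. *)
Lemma nat_neq0 n : (0 < n)%N -> n%:R != 0 :> K.
Proof.
move=> n0; have [m pm ->] := pfactor_coprime p_prime n0.
rewrite natrM natrX mulf_neq0 ?expf_neq0 ?p_neq0 //.
case: (egcdnP m (prime_gt0 p_prime)) => u w uw _.
apply: contraTneq vp_lt1 => m0; rewrite -leNgt.
have : (u * p)%:R = 1 :> K.
  by rewrite uw (eqP pm) natrD natrM m0 mulr0 add0r.
move/(congr1 v); rewrite natrM vM v1 => <-.
by rewrite ler_piMl ?v_ge0 ?v_nat_le1.
Qed.

Lemma fact_neq0 n : n`!%:R != 0 :> K.
Proof. by apply: nat_neq0; rewrite fact_gt0. Qed.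

Lemma expr_small (x e : R) : 0 <= x -> x < 1 -> 0 < e ->
  exists N, forall n, (N <= n)%N -> x ^+ n < e.
Proof.
move=> x0 x1 e0.
have : `|x| < 1 by rewrite ger0_norm.
move/cvg_expr/cvgrPdist_lt => /(_ _ e0) [N _ hN].
by exists N => n /hN /=; rewrite sub0r normrN ger0_norm ?exprn_ge0.
Qed.

(** * Convergence *)

Definition vlim (u : nat -> K) (l : K) : Prop :=
  forall e, 0 < e -> exists N : nat, forall n, (N <= n)%N -> v (u n - l) < e.

Lemma vlimP u l : v (u n - l) @[n --> \oo] --> (0 : R) <-> vlim u l.
Proof.
split.
  move/cvgrPdist_lt => h e e0; have [N _ hN] := h _ e0.
  by exists N => n /hN /=; rewrite sub0r normrN ger0_norm ?v_ge0.
move=> h; apply/cvgrPdist_lt => e e0; have [N hN] := h _ e0.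
by exists N => // n /hN /=; rewrite sub0r normrN ger0_norm ?v_ge0.
Qed.

Lemma vlim_le u l c e (N : nat) :
  vlim u l -> (forall n, (N <= n)%N -> v (u n - c) <= e) -> v (l - c) <= e.
Proof.
move=> ul h; rewrite leNgt; apply/negP => lt_e.
have e0 : 0 <= e by apply: le_trans (h N (leqnn N)); rewrite v_ge0.
have [N' hN'] := ul _ (le_lt_trans e0 lt_e).
have h1 := h _ (leq_maxl N N').
have h2 := hN' _ (leq_maxr N N').
have: v (l - c) < v (l - c).
  apply: (@v_dist_lt (u (maxn N N'))); first by rewrite v_sub.
  exact: le_lt_trans h1 lt_e.
by rewrite ltxx.
Qed.

Lemma vlim_uniq u l l' : vlim u l -> vlim u l' -> l = l'.
Proof.
move=> ul ul'; apply/eqP; rewrite -subr_eq0 -v_eq0 eq_le v_ge0 andbT.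
apply/ler_addgt0Pr => e e0; rewrite add0r.
have [N hN] := ul' _ e0.
by apply: (vlim_le ul (N := N)) => n /hN /ltW.
Qed.

Lemma vsum_eq (f : nat -> K) l : vlim (fun n => \sum_(k < n) f k) l -> vsum v f = l.
Proof.
move=> h; apply: (vlim_uniq _ h); apply/vlimP.
have /vlimP h' := h.
exact: (xgetPex 0 (ex_intro
  [set l | v (\sum_(k < n) f k - l) @[n --> \oo] --> (0 : R)] l h')).
Qed.

Definition vanishes (f : nat -> K) : Prop :=
  forall e, 0 < e -> exists N : nat, forall n, (N <= n)%N -> v (f n) < e.

Lemma sum_tail (f : nat -> K) N n : (N <= n)%N ->
  \sum_(k < n) f k - \sum_(k < N) f k = \sum_(N <= k < n) f k.
Proof.
move=> Nn; rewrite -!(big_mkord xpredT f) (big_cat_nat (leq0n N) Nn) /=.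
by rewrite addrAC subrr add0r.
Qed.

(** In an ultrametric complete field a series converges as soon as its terms
    tend to 0. *)
Lemma series_cvg (f : nat -> K) :
  vanishes f -> exists l, vlim (fun n => \sum_(k < n) f k) l.
Proof.
move=> f0; have [|l hl] := abs_complete v_padic (u := fun n => \sum_(k < n) f k).
  move=> e e0; have [N hN] := f0 _ e0; exists N.
  suff h m n : (N <= m)%N -> (m <= n)%N ->
      v (\sum_(k < n) f k - \sum_(k < m) f k) < e.
    move=> m n Nm Nn; have [mn|nm] := leqP m n; last by apply: h => //; apply: ltnW.
    by rewrite v_sub; apply: h.
  move=> Nm mn; rewrite sum_tail // big_nat v_sum_lt // => k /andP[mk _].
  exact/hN/(leq_trans Nm).
by exists l; apply/vlimP.
Qed.

Lemma series_vanishes (f : nat -> K) l :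
  vlim (fun n => \sum_(k < n) f k) l -> vanishes f.
Proof.
move=> h e e0; have [N hN] := h _ e0; exists N => n Nn.
have -> : f n = \sum_(k < n.+1) f k - \sum_(k < n) f k.
  by rewrite big_ord_recr /= addrAC subrr add0r.
by apply: (@v_dist_lt l); [apply/hN/leqW|rewrite v_sub hN].
Qed.

Lemma vanishes_bounded f : vanishes f -> exists2 B, 0 <= B & forall n, v (f n) <= B.
Proof.
move=> /(_ 1 ltr01)[N hN].
exists (1 + \sum_(k < N) v (f k)) => [|n].
  by rewrite addr_ge0 // sumr_ge0 // => k _; rewrite v_ge0.
have [Nn|nN] := leqP N n.
  apply: le_trans (ltW (hN _ Nn)) _.
  by rewrite lerDl sumr_ge0 // => k _; rewrite v_ge0.
rewrite (bigD1 (Ordinal nN)) //= addrCA lerDl.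
by rewrite addr_ge0 // sumr_ge0 // => k _; rewrite v_ge0.
Qed.

(** * Power series on the open unit disk *)

Lemma vlimI u l :
  (forall e, 0 < e -> exists N : nat, forall n, (N <= n)%N -> v (u n - l) <= e) ->
  vlim u l.
Proof.
move=> h e e0; have [N hN] := h (e / 2%:R) (divr_gt0 e0 (ltr0n _ 2)).
exists N => n /hN /le_lt_trans -> //.
by rewrite ltr_pdivrMr // ltr_pMr // ltr1n.
Qed.

Lemma vlimM u l u' l' :
  vlim u l -> vlim u' l' -> vlim (fun n => u n * u' n) (l * l').
Proof.
move=> h h' e e0.
pose B := 1 + v l + v l'.
have B0 : 0 < B by rewrite /B -addrA ltr_pwDl // addr_ge0 ?v_ge0.
have eB : 0 < Num.min 1 (e / B) by rewrite lt_min ltr01 divr_gt0.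
have [N hN] := h _ eB; have [N' hN'] := h' _ eB.
exists (maxn N N') => n; rewrite geq_max => /andP[/hN a /hN' b].
have [a1 aB] : v (u n - l) < 1 /\ v (u n - l) < e / B.
  by move: a; rewrite lt_min => /andP[].
have [_ bB] : v (u' n - l') < 1 /\ v (u' n - l') < e / B.
  by move: b; rewrite lt_min => /andP[].
have -> : u n * u' n - l * l' = u n * (u' n - l') + (u n - l) * l' by ring.
have unB : v (u n) <= B.
  rewrite -(subrK l (u n)); apply: vD_le.
    by rewrite (le_trans (ltW a1)) // /B -addrA lerDl addr_ge0 ?v_ge0.
  by rewrite /B addrAC lerDr addr_ge0 ?v_ge0.
have l'B : v l' <= B by rewrite /B lerDr addr_ge0 ?v_ge0.
have -> : e = B * (e / B) by rewrite mulrCA divff ?mulr1 // gt_eqF.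
apply: vD_lt; rewrite vM; last rewrite mulrC.
  by apply: le_lt_trans (ler_wpM2r (v_ge0 _) unB) _; rewrite ltr_pM2l.
by apply: le_lt_trans (ler_wpM2r (v_ge0 _) l'B) _; rewrite ltr_pM2l.
Qed.

Lemma vlim_cst c : vlim (fun=> c) c.
Proof. by move=> e e0; exists 0%N => n _; rewrite subrr v0. Qed.

Lemma vlimB u l u' l' :
  vlim u l -> vlim u' l' -> vlim (fun n => u n - u' n) (l - l').
Proof.
move=> h h' e e0; have [N hN] := h _ e0; have [N' hN'] := h' _ e0.
exists (maxn N N') => n; rewrite geq_max => /andP[/hN a /hN' b].
have -> : u n - u' n - (l - l') = (u n - l) - (u' n - l') by ring.
exact: vB_lt.
Qed.

Lemma vlimD u l u' l' :
  vlim u l -> vlim u' l' -> vlim (fun n => u n + u' n) (l + l').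
Proof.
move=> h h'; have := vlimB h (vlimB (vlim_cst 0) h').
by rewrite sub0r opprK; under eq_fun do rewrite sub0r opprK.
Qed.

Lemma eq_vlim u u' l : u =1 u' -> vlim u l -> vlim u' l.
Proof. by move=> uu' h e /h[N hN]; exists N => n /hN; rewrite uu'. Qed.

Definition psum (c : nat -> K) (t l : K) : Prop :=
  vlim (fun n => \sum_(k < n) c k * t ^+ k) l.

(** [d] is the [n]-th Taylor coefficient at [h] of the power series with
    coefficients [c]. *)
Definition taylor_coef (c : nat -> K) (h : K) (n : nat) (d : K) : Prop :=
  vlim (fun N => \sum_(k < N) c k * ('C(k, n)%:R * h ^+ (k - n))) d.

Definition disk_series (c : nat -> K) : Prop :=
  forall t, v t < 1 -> vanishes (fun k => c k * t ^+ k).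

Lemma taylor_coef_ex c h n :
  disk_series c -> v h < 1 -> exists d, taylor_coef c h n d.
Proof.
move=> cc h1.
apply: (@series_cvg (fun k => c k * ('C(k, n)%:R * h ^+ (k - n)))).
(* a nonzero t at least as large as h makes t ^+ n a fixed nonzero factor *)
have [t [t0 t1 ht]] : exists t, [/\ t != 0, v t < 1 & v h <= v t].
  have [->|h0] := eqVneq h 0; last by exists h; rewrite lexx.
  by exists p%:R; rewrite p_neq0 vp_lt1 v0 v_ge0.
have tn : 0 < v t ^+ n by rewrite exprn_gt0 // v_gt0.
move=> e e0; have [N hN] := cc _ t1 _ (mulr_gt0 e0 tn).
exists N => k /hN hk; rewrite -(ltr_pM2r tn).
apply: le_lt_trans hk; rewrite !vM !vX -!mulrA ler_wpM2l ?v_ge0 //.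
have [kn|nk] := ltnP k n.
  by rewrite bin_small // v0 mul0r exprn_ge0 ?v_ge0.
rewrite mulrA -[leRHS]mul1r -[in leRHS](subnK nk) exprD.
rewrite -mulrA ler_pM ?mulr_ge0 ?exprn_ge0 ?v_ge0 ?v_nat_le1 //.
by rewrite ler_wpM2r ?exprn_ge0 ?v_ge0 // lerXn2r ?nnegrE ?v_ge0.
Qed.

Lemma newton_sum (h t : K) k M : (k < M)%N ->
  \sum_(n < M) 'C(k, n)%:R * h ^+ (k - n) * t ^+ n = (h + t) ^+ k.
Proof.
move=> kM; rewrite exprDn.
rewrite -(big_mkord xpredT (fun n => 'C(k, n)%:R * h ^+ (k - n) * t ^+ n)).
rewrite (big_cat_nat (leq0n k.+1) kM) /= [X in _ + X]big_nat [X in _ + X]big1.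
  rewrite addr0 big_mkord; apply: eq_bigr => i _.
  by rewrite -mulrA mulr_natl.
by move=> n /andP[kn _]; rewrite bin_small // !mul0r.
Qed.

(** Truncate to the polynomial of degree less than N, for which Taylor's
    formula is the binomial theorem.  On a circle that contains both h and t
    in its closed disk the tail beyond N changes each Taylor term by no more
    than the largest omitted term. *)
Lemma taylor_psum c h (d : nat -> K) t l :
  disk_series c -> v h < 1 -> v t < 1 -> (forall n, taylor_coef c h n (d n)) ->
  psum c (h + t) l -> psum d t l.
Proof.
move=> cc h1 t1 hd hl.
have [r [r1 hr tr]] : exists r, [/\ v r < 1, v h <= v r & v t <= v r].
  have [ht|th] := leP (v h) (v t); first by exists t.
  by exists h; split => //; apply: ltW.
apply: vlimI => e e0; have [N1 hN1] := cc _ r1 _ e0; have [N2 hN2] := hl _ e0.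
pose N := maxn N1 N2.
pose b n := \sum_(k < N) c k * ('C(k, n)%:R * h ^+ (k - n)).
exists N => M NM; apply: (@v_dist_le (\sum_(n < M) b n * t ^+ n)).
  rewrite -sumrB; apply: v_sum_le (ltW e0) _ => n _.
  rewrite -mulrBl.
  have := vlimM (vlimB (hd n) (vlim_cst (b n))) (vlim_cst (t ^+ n)).
  move/(@vlim_le _ _ 0 e N); rewrite subr0; apply=> N' NN'.
  rewrite subr0 (sum_tail (fun k => c k * ('C(k, n)%:R * h ^+ (k - n))) NN').
  rewrite big_distrl /= big_nat v_sum_le ?(ltW e0) // => k /andP[Nk _].
  apply: le_trans (ltW (hN1 k (leq_trans (leq_maxl _ _) Nk))).
  rewrite -mulrA !vM !vX ler_wpM2l ?v_ge0 //.
  have [kn|nk] := ltnP k n.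
    by rewrite bin_small // v0 !mul0r exprn_ge0 ?v_ge0.
  rewrite -[leRHS]mul1r -[in leRHS](subnK nk) exprD -mulrA.
  by rewrite !ler_pM ?mulr_ge0 ?exprn_ge0 ?v_ge0 ?v_nat_le1 // lerXn2r ?nnegrE ?v_ge0.
have -> : \sum_(n < M) b n * t ^+ n = \sum_(k < N) c k * (h + t) ^+ k.
  under eq_bigr do rewrite big_distrl /=.
  rewrite exchange_big; apply: eq_bigr => k _ /=.
  under eq_bigr do rewrite -mulrA.
  by rewrite -big_distrr newton_sum // (leq_trans (ltn_ord k)).
by apply/ltW/hN2/leq_maxr.
Qed.

Lemma taylor_coef_deriv c h n d : taylor_coef c h n.+1 d ->
  taylor_coef (fun k => k.+1%:R * c k.+1) h n (n.+1%:R * d).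
Proof.
move=> hd; have hd' : vlim (fun N =>
    n.+1%:R * \sum_(k < N.+1) c k * ('C(k, n.+1)%:R * h ^+ (k - n.+1))) (n.+1%:R * d).
  apply: vlimM (vlim_cst _) _ => e e0; have [N hN] := hd _ e0.
  by exists N => N' NN'; apply/hN/leqW.
apply: eq_vlim hd' => N; rewrite big_ord_recl bin0n mul0r mulr0 add0r big_distrr.
apply: eq_bigr => k _ /=; rewrite /bump /= add1n subSS.
have := mul_bin_diag k.+1 n => /(congr1 (fun m => m%:R : K)); rewrite !natrM => bE.
have -> : n.+1%:R * (c k.+1 * ('C(k.+1, n.+1)%:R * h ^+ (k - n)))
  = c k.+1 * h ^+ (k - n) * (n.+1%:R * 'C(k.+1, n.+1)%:R) by ring.
by rewrite -bE /=; ring.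
Qed.

(** * Local behaviour at the centre *)

Lemma psum_lead c m : disk_series c -> (forall k, (k < m)%N -> c k = 0) ->
  exists2 C, 0 <= C & forall t l, v t <= v p%:R -> psum c t l ->
    v (l - c m * t ^+ m) <= C * v t ^+ m.+1.
Proof.
move=> cc c0; have [B B0 hB] := vanishes_bounded (cc _ vp_lt1).
have pp n : 0 < v p%:R ^+ n by rewrite exprn_gt0 ?vp_gt0.
exists (B / v p%:R ^+ m.+1) => [|t l tp]; first by rewrite divr_ge0 // ltW.
move/(@vlim_le _ _ _ _ m.+1); apply=> n mn.
rewrite (bigD1 (Ordinal mn)) //= addrAC subrr add0r.
have C0 : 0 <= B / v p%:R ^+ m.+1 * v t ^+ m.+1.
  by rewrite !mulr_ge0 ?invr_ge0 ?exprn_ge0 ?v_ge0.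
apply: v_sum_le => // k km.
have [lt_km|] := ltnP k m; first by rewrite c0 // mul0r v0.
rewrite leq_eqVlt eq_sym -[_ == _]/(k == Ordinal mn) (negPf km) /= => lt_mk.
rewrite -(subnK lt_mk) exprD mulrA vM vX ler_wpM2r ?exprn_ge0 ?v_ge0 //.
rewrite ler_pdivlMr // (le_trans _ (hB k)) // -[in leRHS](subnK lt_mk) exprD mulrA.
rewrite [leRHS]vM vX ler_wpM2r ?exprn_ge0 ?v_ge0 // !vM ler_wpM2l ?v_ge0 //.
by rewrite !vX lerXn2r ?nnegrE ?v_ge0.
Qed.

Lemma psum0 c t : (forall k, c k = 0) -> psum c t 0.
Proof.
move=> c0; apply: eq_vlim (vlim_cst 0) => n; rewrite big1 // => k _.
by rewrite c0 mul0r.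
Qed.

Lemma psum_centre c l : psum c 0 l -> l = c 0.
Proof.
move=> h; apply: vlim_uniq h _ => e e0; exists 1%N => -[//|n] _.
rewrite big_ord_recl expr0 mulr1 big1 ?addr0 ?subrr ?v0 // => k _.
by rewrite exprS mul0r mulr0.
Qed.

Lemma mxsum_cvgP (c : nat -> 'M[K]_2) t L :
  mxsum_cvg v (fun n => t ^+ n *: c n) L <->
  forall i j, psum (fun n => c n i j) t (L i j).
Proof.
have E i j : (fun n => v ((\sum_(k < n) t ^+ k *: c k - L) i j)) =
    (fun n => v (\sum_(k < n) c k i j * t ^+ k - L i j)).
  apply/funext => n; rewrite !mxE summxE; congr (v (_ - _)).
  by apply: eq_bigr => k _; rewrite !mxE mulrC.
split=> h i j; first by apply/vlimP; rewrite -E; apply: h.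
by rewrite E; apply/vlimP/h.
Qed.

Lemma disk_derivativeP z Y dY : disk_derivative v z Y dY <->
  exists c : nat -> 'M[K]_2, forall l, v (l - z) < 1 -> forall i j,
    psum (fun n => c n i j) (l - z) (Y l i j) /\
    psum (fun n => n.+1%:R * c n.+1 i j) (l - z) (dY l i j).
Proof.
split=> -[c hc]; exists c => l lz.
  have [/mxsum_cvgP h1 /mxsum_cvgP h2] := hc l lz.
  move=> i j; split; first exact: h1.
  by apply: eq_vlim (h2 i j) => n; apply: eq_bigr => k _; rewrite mxE.
split; apply/mxsum_cvgP => i j; first by case: (hc l lz i j).
case: (hc l lz i j) => _; apply: eq_vlim => n.
by apply: eq_bigr => k _; rewrite mxE.
Qed.

Lemma psum_vanishes c t l : psum c t l -> vanishes (fun k => c k * t ^+ k).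
Proof. exact: (series_vanishes (f := fun k => c k * t ^+ k)). Qed.

(** Two open unit disks that meet coincide, and an analytic function may be
    expanded at any of their points. *)
Lemma disk_derivative_recentre z w Y dY : v (w - z) < 1 ->
  disk_derivative v z Y dY -> disk_derivative v w Y dY.
Proof.
move=> wz /disk_derivativeP[c hc]; apply/disk_derivativeP.
have dc i j : disk_series (fun n => c n i j).
  by move=> t t1; have := hc (t + z); rewrite addrK => /(_ t1 i j)[/psum_vanishes].
have dc' i j : disk_series (fun n => n.+1%:R * c n.+1 i j).
  by move=> t t1; have := hc (t + z); rewrite addrK => /(_ t1 i j)[_ /psum_vanishes].
have /choice[d hd] : forall x : nat * ('I_2 * 'I_2), exists d,
    taylor_coef (fun n => c n x.2.1 x.2.2) (w - z) x.1 d.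
  by case=> n [i j] /=; apply: taylor_coef_ex.
exists (fun n => \matrix_(i, j) d (n, (i, j))) => l lw i j.
have lz : v (l - z) < 1 by apply: v_dist_lt lw wz.
have [Yl dYl] := hc l lz i j.
have zE : l - z = (w - z) + (l - w) by ring.
rewrite zE in Yl dYl; split.
  apply: taylor_psum Yl => // n; rewrite mxE; exact: (hd (n, (i, j))).
apply: taylor_psum dYl => // n; rewrite mxE.
exact: taylor_coef_deriv (hd (n.+1, (i, j))).
Qed.

Lemma psum_linear n (a : 'I_n -> K) (c : 'I_n -> nat -> K) t l :
  (forall k, psum (c k) t (l k)) ->
  psum (fun m => \sum_k a k * c k m) t (\sum_k a k * l k).
Proof.
move=> h.
suff : vlim (fun N => \sum_k a k * \sum_(m < N) c k m * t ^+ m) (\sum_k a k * l k).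
  apply: eq_vlim => N; under eq_bigr do rewrite big_distrr.
  rewrite exchange_big; apply: eq_bigr => m _; rewrite big_distrl /=.
  by apply: eq_bigr => k _; rewrite mulrA.
elim: (index_enum _) => [|k s IH].
  by apply: eq_vlim (vlim_cst _) => N; rewrite !big_nil.
rewrite big_cons; apply: (eq_vlim _ (vlimD (vlimM (vlim_cst _) (h k)) IH)) => N.
by rewrite big_cons.
Qed.

Lemma disk_derivative_mull z A Y dY :
  disk_derivative v z Y dY ->
  disk_derivative v z (fun l => A *m Y l) (fun l => A *m dY l).
Proof.
move=> /disk_derivativeP[c hc]; apply/disk_derivativeP.
exists (fun n => A *m c n) => l lz i j; rewrite !mxE; split.
  have := psum_linear (A i) (fun k => (hc l lz k j).1).
  by apply: eq_vlim => n; apply: eq_bigr => k _; rewrite mxE.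
have := psum_linear (A i) (fun k => (hc l lz k j).2).
apply: eq_vlim => n; apply: eq_bigr => k _; rewrite mxE big_distrr /=.
by congr (_ * _); apply: eq_bigr => m _; rewrite mulrCA.
Qed.

Lemma disk_derivativeB z Y dY Z dZ :
  disk_derivative v z Y dY -> disk_derivative v z Z dZ ->
  disk_derivative v z (fun l => Y l - Z l) (fun l => dY l - dZ l).
Proof.
move=> /disk_derivativeP[c hc] /disk_derivativeP[d hd]; apply/disk_derivativeP.
exists (fun n => c n - d n) => l lz i j; rewrite !mxE.
have [[c1 c2] [d1 d2]] := (hc l lz i j, hd l lz i j).
split; [have := vlimB c1 d1|have := vlimB c2 d2]; apply: eq_vlim => n;
  by rewrite -sumrB; apply: eq_bigr => k _; rewrite !mxE; ring.
Qed.

(** If E is not 0, let t ^+ n, n > 0, be its leading power at the centre.  The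
    derivative has leading power t ^+ n.-1, because n is not 0 in K, whereas
    E *m G is O(t ^+ n). *)
Lemma linear_ode_zero (w : K) (G : K -> 'M[K]_2) (E : K -> 'M[K]_2) :
  (forall l i j, v (l - w) < 1 -> v (G l i j) <= 1) ->
  disk_derivative v w E (fun l => E l *m G l) -> E w = 0 ->
  forall l, v (l - w) < 1 -> E l = 0.
Proof.
move=> G1 /disk_derivativeP[e he] Ew.
have es i j : disk_series (fun n => e n i j).
  by move=> t t1; have := he (t + w); rewrite addrK => /(_ t1 i j)[/psum_vanishes].
have es' i j : disk_series (fun n => n.+1%:R * e n.+1 i j).
  by move=> t t1; have := he (t + w); rewrite addrK => /(_ t1 i j)[_ /psum_vanishes].
suff e0 n i j : e n i j = 0.
  move=> l lw; apply/matrixP => i j; rewrite mxE.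
  by apply: vlim_uniq (he l lw i j).1 (psum0 _ _) => n; rewrite e0.
elim/ltn_ind: n i j => -[|n] IH i j.
  have := (he w); rewrite subrr v0 => /(_ ltr01 i j)[/psum_centre <- _].
  by rewrite Ew mxE.
have at_w t : v t <= v p%:R -> v ((t + w) - w) < 1.
  by move=> tp; rewrite addrK (le_lt_trans tp) // vp_lt1.
have /choice[C hC] : forall k, exists C, 0 <= C /\ forall t, v t <= v p%:R ->
    v (E (t + w) i k) <= C * v t ^+ n.+1.
  move=> k; have [C C0 hC] := psum_lead (es i k) (fun m mn => IH m (ltnW mn) i k).
  exists C; split=> // t tp; have := hC _ _ tp; rewrite IH // mul0r.
  have [+ _] := he _ (at_w t tp) i k; rewrite addrK => h /(_ _ h).
  by rewrite subr0.
have [C' C'0 hC'] := psum_lead (m := n) (es' i j)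
  (fun m mn => etrans (congr1 _ (IH m.+1 mn i j)) (mulr0 _)).
pose B := C' + \sum_k C k.
have B0 : 0 <= B by rewrite addr_ge0 // sumr_ge0 // => k _; case: (hC k).
have bound t : t != 0 -> v t <= v p%:R -> v (n.+1%:R * e n.+1 i j) <= B * v t.
  move=> t0 tp; have tn : 0 < v t ^+ n by rewrite exprn_gt0 // v_gt0.
  have [_ +] := he _ (at_w t tp) i j; rewrite addrK => /(hC' _ _ tp) lead.
  have T0 : 0 <= v t ^+ n.+1 by rewrite exprn_ge0 ?v_ge0.
  rewrite -(ler_pM2r tn) -[leRHS]mulrA -exprS -vX -vM.
  rewrite -[X in v X](subKr ((E (t + w) *m G (t + w)) i j)).
  have leB C1 : 0 <= C1 -> C1 <= B -> C1 * v t ^+ n.+1 <= B * v t ^+ n.+1.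
    by move=> _ ?; rewrite ler_wpM2r.
  apply: vB_le; last first.
    by apply: le_trans lead _; rewrite leB // lerDl sumr_ge0 // => k _; case: (hC k).
  rewrite mxE; apply: v_sum_le => [|k _]; first by rewrite mulr_ge0.
  have [Ck0 /(_ _ tp) hCk] := hC k.
  rewrite vM -[leRHS]mulr1 ler_pM ?v_ge0 ?G1 ?at_w //.
  apply: le_trans hCk _; rewrite leB // /B (bigD1 k) //= addrCA lerDl addr_ge0 //.
  by rewrite sumr_ge0 // => m _; case: (hC m).
apply/eqP; rewrite -(mulrI_eq0 _ (lregP (nat_neq0 (ltn0Sn n)))) -v_eq0.
rewrite eq_le v_ge0 andbT; apply/ler_addgt0Pr => x x0; rewrite add0r.
(* the bound at t = p ^+ N.+1 tends to 0 as N grows *)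
have [N /(_ N.+1 (leqW (leqnn N))) hN] :=
  expr_small (v_ge0 _) vp_lt1 (divr_gt0 x0 (ltr_wpDl B0 ltr01)).
have tp : v (p%:R ^+ N.+1) <= v p%:R.
  by rewrite vX exprS ler_piMr ?v_ge0 // exprn_ile1 ?v_ge0 // ltW // vp_lt1.
apply: le_trans (bound _ (expf_neq0 _ p_neq0) tp) _.
rewrite vX; apply: le_trans (_ : (B + 1) * v p%:R ^+ N.+1 <= _).
  by rewrite ler_wpM2r ?exprn_ge0 ?v_ge0 // lerDl.
by rewrite mulrC -ler_pdivlMr ?ltr_wpDl // ltW.
Qed.

(** * Solution matrices *)

Lemma Zp_le1 x : Defs.Zp v x -> v x <= 1.
Proof.
move=> /(_ _ ltr01)[n /ltW xn]; rewrite -(subrK n%:R x).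
by apply: vD_le; rewrite ?v_nat_le1.
Qed.

Lemma unit_region_close z l : unit_region v z -> v (l - z) < 1 -> unit_region v l.
Proof.
move=> [z1 z1'] lz; split; first exact: v_close lz z1.
apply: v_close z1'; suff -> : 1 - l - (1 - z) = z - l by rewrite v_sub.
by ring.
Qed.

Lemma Gmx_le1 (a : 'rV[K]_3) l i j : (forall k, Defs.Zp v (a 0 k)) -> unit_region v l ->
  v (Gmx a l i j) <= 1.
Proof.
move=> az [l1 l1']; have a1 k := Zp_le1 (az k).
rewrite mxE; do 2! case: ifP => _; rewrite ?vN vM vV ?l1 ?l1' invr1 mulr1;
  by rewrite /pa1 /pa2 /pa3 ?vB_le ?vD_le.
Qed.

Lemma solution_matrix_mul (a : 'rV[K]_3) z w (Y Z : K -> 'M[K]_2) :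
  (forall k, Defs.Zp v (a 0 k)) -> unit_region v z -> v (w - z) < 1 ->
  solution_matrix v a z Y -> solution_matrix v a w Z ->
  forall l, v (l - w) < 1 -> Y l = Y w *m Z l.
Proof.
move=> az zU wz [_ hY] [Zw hZ] l lw.
have wU := unit_region_close zU wz.
apply/eqP; rewrite -subr_eq0; apply/eqP.
pose E l := Y l - Y w *m Z l.
apply: (@linear_ode_zero w (Gmx a) E) => //.
- by move=> x i j xw; apply: Gmx_le1 (unit_region_close wU xw).
- have -> : (fun l => E l *m Gmx a l) =
      (fun l => Y l *m Gmx a l - Y w *m (Z l *m Gmx a l)).
    by apply/funext => x; rewrite mulmxBl mulmxA.
  exact: disk_derivativeB (disk_derivative_recentre wz hY) (disk_derivative_mull _ hZ).
- by rewrite /E Zw mulmx1 subrr.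
Qed.

(** Evolution along a path z, w, l, all in one residue disk. *)
Lemma Csol_mul (a : 'rV[K]_3) z w l :
  (forall k, Defs.Zp v (a 0 k)) ->
  (forall z, unit_region v z -> exists Y, solution_matrix v a z Y) ->
  unit_region v z -> v (w - z) < 1 -> v (l - w) < 1 ->
  Csol v a z l = Csol v a z w *m Csol v a w l.
Proof.
move=> az ex zU wz lw.
apply: (solution_matrix_mul az zU wz) lw; last first.
  exact: (xgetPex _ (ex _ (unit_region_close zU wz))).
exact: (xgetPex _ (ex _ zU)).
Qed.

Lemma Csol_centre a z :
  (forall z, unit_region v z -> exists Y, solution_matrix v a z Y) ->
  unit_region v z -> Csol v a z z = 1%:M.
Proof. by move=> ex zU; case: (xgetPex (fun=> 0) (ex _ zU)). Qed.

(** * The ring of p-adic integers *)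

Lemma Zp_nat n : Defs.Zp v n%:R.
Proof. by move=> e e0; exists n; rewrite subrr v0. Qed.

Lemma ZpD x y : Defs.Zp v x -> Defs.Zp v y -> Defs.Zp v (x + y).
Proof.
move=> hx hy e e0; have [[n hn] [m hm]] := (hx e e0, hy e e0).
by exists (n + m)%N; rewrite natrD opprD addrACA vD_lt.
Qed.

Lemma ZpM x y : Defs.Zp v x -> Defs.Zp v y -> Defs.Zp v (x * y).
Proof.
move=> hx hy e e0; have [[n hn] [m hm]] := (hx e e0, hy e e0).
exists (n * m)%N; rewrite natrM.
have -> : x * y - n%:R * m%:R = x * (y - m%:R) + (x - n%:R) * m%:R by ring.
apply: vD_lt; rewrite vM.
  by apply: le_lt_trans hm; rewrite ler_piMl ?v_ge0 // Zp_le1.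
by apply: le_lt_trans hn; rewrite ler_piMr ?v_ge0 // v_nat_le1.
Qed.

(** The numbers p ^ N - 1 tend to -1. *)
Lemma ZpN x : Defs.Zp v x -> Defs.Zp v (- x).
Proof.
rewrite -mulN1r; apply: ZpM => e e0.
have [N /(_ N (leqnn N)) hN] := expr_small (v_ge0 _) vp_lt1 e0.
exists (p ^ N).-1; rewrite -subn1 natrB ?expn_gt0 ?prime_gt0 //.
have -> : -1 - ((p ^ N)%:R - 1%:R) = - p%:R ^+ N :> K by rewrite natrX; ring.
by rewrite vN vX.
Qed.

Lemma Zp_int (m : int) : Defs.Zp v m%:~R.
Proof. by case: m => n; [|rewrite NegzE mulrNz; apply: ZpN]; apply: Zp_nat. Qed.

Lemma Zp_aeval f (a : 'rV[K]_3) :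
  (forall k, Defs.Zp v (a 0 k)) -> Defs.Zp v (aeval f a).
Proof.
move=> az; apply: ZpD (Zp_int _); rewrite mxE; apply: (big_ind (Defs.Zp v)).
- exact: Zp_nat 0%N.
- exact: ZpD.
- by move=> k _; rewrite mxE; apply: ZpM (Zp_int _).
Qed.

(** * p-adic powers of units congruent to 1 *)

Lemma v_falling_sub x y k : v x <= 1 -> v y <= 1 ->
  v (\prod_(i < k) (x - i%:R) - \prod_(i < k) (y - i%:R)) <= v (x - y).
Proof.
move=> x1 y1; have le1 z n : v z <= 1 -> v (\prod_(i < n) (z - i%:R)) <= 1.
  move=> z1; rewrite v_prod; apply: Num.Theory.prodr_ile1 => i _.
  by rewrite v_ge0 vB_le ?v_nat_le1.
elim: k => [|k IH]; first by rewrite !big_ord0 subrr v0 v_ge0.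
pose X := \prod_(i < k) (x - i%:R); pose Y := \prod_(i < k) (y - i%:R).
rewrite !big_ord_recr /= -/X -/Y -/X -/Y in IH *.
have -> : X * (x - k%:R) - Y * (y - k%:R) = X * (x - y) + (X - Y) * (y - k%:R) by ring.
apply: vD_le; rewrite vM; first by rewrite ler_piMl ?v_ge0 ?le1.
by apply: le_trans IH; rewrite ler_piMr ?v_ge0 // vB_le ?v_nat_le1.
Qed.

Lemma binom_nat n k : binom n%:R k = 'C(n, k)%:R :> K.
Proof.
have E : \prod_(i < k) (n%:R - i%:R) = (n ^_ k)%:R :> K.
  elim: k => [|k IH]; first by rewrite big_ord0.
  rewrite big_ord_recr /= IH ffactnSr natrM.
  have [kn|nk] := leqP k n; first by rewrite natrB.
  by rewrite ffact_small // !mul0r.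
by rewrite /binom E -bin_ffact natrM mulfK ?fact_neq0.
Qed.

Lemma v_binom_sub x y k : v x <= 1 -> v y <= 1 ->
  v (binom x k - binom y k) <= v (x - y) / v k`!%:R.
Proof.
move=> x1 y1; rewrite /binom -mulrBl vM vV ler_wpM2r ?invr_ge0 ?v_ge0 //.
exact: v_falling_sub.
Qed.

Lemma v_binom_le1 s k : Defs.Zp v s -> v (binom s k) <= 1.
Proof.
move=> hs; have k0 : 0 < v k`!%:R by rewrite v_gt0 fact_neq0.
have [n sn] := hs _ k0.
rewrite -(subrK (binom n%:R k) (binom s k)); apply: vD_le.
  apply: le_trans (v_binom_sub _ (Zp_le1 hs) (v_nat_le1 n)) _.
  by rewrite ler_pdivrMr // mul1r ltW.
by rewrite binom_nat v_nat_le1.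
Qed.

Lemma binpow_psum u s : Defs.Zp v s -> v (u - 1) < 1 ->
  psum (binom s) (u - 1) (binpow v u s).
Proof.
move=> hs u1.
have [|l hl] := @series_cvg (fun n => binom s n * (u - 1) ^+ n).
  move=> e e0; have [N hN] := expr_small (v_ge0 _) u1 e0; exists N => n /hN.
  by apply: le_lt_trans; rewrite vM vX ler_piMl ?exprn_ge0 ?v_ge0 ?v_binom_le1.
by rewrite /binpow (vsum_eq hl).
Qed.

(** The binomial series interpolates the ordinary powers: terms of large index
    are uniformly small, and the finitely many others are continuous in s. *)
Lemma binpow_approx u s e : Defs.Zp v s -> v (u - 1) < 1 -> 0 < e ->
  exists2 d : R, 0 < d &
    forall n : nat, v (s - n%:R) < d -> v (binpow v u s - u ^+ n) < e.
Proof.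
move=> hs u1 e0; have [k hk] := expr_small (v_ge0 _) u1 e0.
exists (e * v k`!%:R) => [|n sn]; first by rewrite mulr_gt0 // v_gt0 fact_neq0.
have [N hN] := binpow_psum hs u1 e0.
pose M := maxn N (maxn k n.+1).
apply: (@v_dist_lt (\sum_(i < M) binom s i * (u - 1) ^+ i)).
  by rewrite v_sub hN // leq_maxl.
have -> : u ^+ n = \sum_(i < M) binom n%:R i * (u - 1) ^+ i.
  rewrite -[in LHS](subrKC 1 u) -(@newton_sum _ _ n M).
    by apply: eq_bigr => i _; rewrite binom_nat expr1n mulr1.
  by rewrite /M !leq_max leqnn !orbT.
rewrite -sumrB; apply: v_sum_lt => // i _; rewrite -mulrBl vM vX.
have [ki|ik] := leqP k i.
  apply: le_lt_trans (hk _ ki); rewrite ler_piMl ?exprn_ge0 ?v_ge0 //.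
  by rewrite vB_le ?v_binom_le1 //; apply: Zp_nat.
apply: le_lt_trans (_ : v (binom s i - binom n%:R i) < e).
  by rewrite ler_piMr ?v_ge0 // exprn_ile1 ?v_ge0 // ltW.
apply: le_lt_trans (v_binom_sub _ (Zp_le1 hs) (v_nat_le1 n)) _.
rewrite ltr_pdivrMr ?v_gt0 ?fact_neq0 //; apply: lt_le_trans sn _.
rewrite ler_wpM2l ?(ltW e0) //.
have -> : k`! = (i`! * ('C(k, i) * (k - i)`!))%N by rewrite mulnCA bin_fact // ltnW.
by rewrite natrM vM ler_piMr ?v_ge0 ?v_nat_le1.
Qed.

Lemma eq_small x y : (forall e, 0 < e -> v (x - y) < e) -> x = y.
Proof.
move=> h; apply/eqP; rewrite -subr_eq0 -v_eq0 eq_le v_ge0 andbT.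
by apply/ler_addgt0Pr => e e0; rewrite add0r ltW ?h.
Qed.

Lemma v_unit1 u : v (u - 1) < 1 -> v u = 1.
Proof. by move=> h; rewrite (v_close h v1). Qed.

Lemma v_mul_sub x y x' y' e : v x <= 1 -> v y' <= 1 ->
  v (x - x') < e -> v (y - y') < e -> v (x * y - x' * y') < e.
Proof.
move=> x1 y1 hx hy.
have -> : x * y - x' * y' = x * (y - y') + (x - x') * y' by ring.
apply: vD_lt; rewrite vM.
  by apply: le_lt_trans hy; rewrite ler_piMl ?v_ge0.
by apply: le_lt_trans hx; rewrite ler_piMr ?v_ge0.
Qed.

Lemma v_binpow_le1 u s : Defs.Zp v s -> v (u - 1) < 1 -> v (binpow v u s) <= 1.
Proof.
move=> hs u1; have [d d0 hd] := binpow_approx hs u1 ltr01.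
by have [n /hd h] := hs _ d0; rewrite (v_close h (y := u ^+ n) (e := 1)) //
  vX (v_unit1 u1) expr1n.
Qed.

Lemma binpowMl u u' s : Defs.Zp v s -> v (u - 1) < 1 -> v (u' - 1) < 1 ->
  binpow v (u * u') s = binpow v u s * binpow v u' s.
Proof.
move=> hs hu hu'.
have huu' : v (u * u' - 1) < 1.
  have: v (u * u' - 1 * 1) < 1 by apply: v_mul_sub; rewrite // ?v1 ?(v_unit1 hu).
  by rewrite mulr1.
apply: eq_small => e e0.
have [d d0 hd] := binpow_approx hs huu' e0.
have [d1 d10 hd1] := binpow_approx hs hu e0.
have [d2 d20 hd2] := binpow_approx hs hu' e0.
have [|n] := hs (Num.min d (Num.min d1 d2)); first by rewrite !lt_min d0 d10.
rewrite !lt_min => /and3P[/hd h /hd1 h1 /hd2 h2].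
apply: v_dist_lt h _; rewrite exprMn; apply: v_mul_sub; rewrite ?v_binpow_le1 //.
- by rewrite vX (v_unit1 hu) expr1n.
- by rewrite v_sub.
- by rewrite v_sub.
Qed.

Lemma binpowD u s s' : Defs.Zp v s -> Defs.Zp v s' -> v (u - 1) < 1 ->
  binpow v u (s + s') = binpow v u s * binpow v u s'.
Proof.
move=> hs hs' hu; apply: eq_small => e e0.
have [d d0 hd] := binpow_approx (ZpD hs hs') hu e0.
have [d1 d10 hd1] := binpow_approx hs hu e0.
have [d2 d20 hd2] := binpow_approx hs' hu e0.
have [|n] := hs (Num.min d d1); first by rewrite lt_min d0.
rewrite lt_min => /andP[nd /hd1 h1].
have [|m] := hs' (Num.min d d2); first by rewrite lt_min d0.
rewrite lt_min => /andP[md /hd2 h2].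
apply: (@v_dist_lt (u ^+ (n + m))).
  by apply: hd; rewrite natrD opprD addrACA vD_lt.
rewrite exprD; apply: v_mul_sub; rewrite ?v_binpow_le1 //.
- by rewrite vX (v_unit1 hu) expr1n.
- by rewrite v_sub.
- by rewrite v_sub.
Qed.

Lemma binpow_exp0 u : v (u - 1) < 1 -> binpow v u 0 = 1.
Proof.
move=> hu; apply: eq_small => e e0.
have [d d0 hd] := binpow_approx (Zp_nat 0) hu e0.
by have := hd 0%N; rewrite subrr v0 expr0; apply.
Qed.

Lemma binpow1 s : Defs.Zp v s -> binpow v 1 s = 1.
Proof.
have h1 : v (1 - 1) < 1 by rewrite subrr v0.
move=> hs; apply: eq_small => e e0; have [d d0 hd] := binpow_approx hs h1 e0.
by have [n /hd] := hs _ d0; rewrite expr1n.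
Qed.

Lemma binpow_ratio x y s : Defs.Zp v s -> v x = 1 -> v y = 1 -> v (x - y) < 1 ->
  binpow v (y / x) s = binpow v (x / y) (- s).
Proof.
move=> hs x1 y1 xy.
have nz z : v z = 1 -> z != 0 by move=> z1; rewrite -v_eq0 z1 oner_eq0.
have hu : v (x / y - 1) < 1.
  by rewrite -(divff (nz _ y1)) -mulrBl vM vV y1 invr1 mulr1.
have hu' : v (y / x - 1) < 1.
  by rewrite -(divff (nz _ x1)) -mulrBl vM vV x1 invr1 mulr1 v_sub.
have h : binpow v (x / y) s * binpow v (x / y) (- s) = 1.
  by rewrite -binpowD ?subrr ?binpow_exp0 //; apply: ZpN.
rewrite -[LHS]mulr1 -h mulrA -binpowMl // mulrA divfK ?divff ?nz //.
by rewrite binpow1 ?mul1r.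
Qed.

Lemma binpow_change x y q s : Defs.Zp v s -> v x = 1 -> v q = 1 ->
  v (y - x) < 1 -> v (x - q) < 1 ->
  binpow v (x / y) s * binpow v (x / q) (- s) = binpow v (y / q) (- s).
Proof.
move=> hs x1 q1 yx xq; have y1 := v_close yx x1.
have nz z : v z = 1 -> z != 0 by move=> z1; rewrite -v_eq0 z1 oner_eq0.
rewrite binpow_ratio // -binpowMl; first by rewrite mulrA divfK ?nz.
- exact: ZpN.
- by rewrite -(divff (nz _ x1)) -mulrBl vM vV x1 invr1 mulr1.
- by rewrite -(divff (nz _ q1)) -mulrBl vM vV q1 invr1 mulr1.
Qed.

(** * Frobenius and the anharmonic group on the unit region *)

Lemma v_frob_add x y : v x <= 1 -> v y <= 1 ->
  v ((x + y) ^+ p - (x ^+ p + y ^+ p)) < 1.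
Proof.
move=> x1 y1; rewrite exprDn (bigD1 ord0) //= (bigD1 ord_max) /=; last first.
  by rewrite -val_eqE /= -lt0n prime_gt0.
rewrite subn0 subnn bin0 binn !expr0 mulr1 mul1r !mulr1n addrA.
rewrite [X in v (X - _)]addrC addrK.
apply: v_sum_lt => // i /andP[i0 ip].
have /(prime_dvd_bin p_prime)/dvdnP[m ->] : (0 < i < p)%N.
  by rewrite lt0n i0 ltn_neqAle -ltnS ltn_ord andbT.
rewrite -mulr_natr natrM mulrA vM; apply: le_lt_trans vp_lt1.
by rewrite ler_piMl ?v_ge0 // !vM !mulr_ile1 ?mulr_ge0 ?v_ge0 ?vX ?exprn_ile1
  ?exprn_ge0 ?v_ge0 ?v_nat_le1.
Qed.

Lemma v_frob_1sub l : odd p -> v l <= 1 -> v ((1 - l) ^+ p - (1 - l ^+ p)) < 1.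
Proof.
move=> p_odd l1; have := @v_frob_add 1 (- l); rewrite v1 vN expr1n exprNn.
by rewrite -signr_odd p_odd expr1 mulN1r; apply.
Qed.

Lemma frob_unit_region l : odd p -> unit_region v l -> unit_region v (l ^+ p).
Proof.
move=> p_odd [l1 l1']; split; first by rewrite vX l1 expr1n.
apply: v_close (_ : v ((1 - l) ^+ p) = 1); last by rewrite vX l1' expr1n.
by rewrite v_sub v_frob_1sub ?l1.
Qed.

Lemma unit_region_neq l : unit_region v l -> l != 0 /\ 1 - l != 0.
Proof. by move=> [l1 l1']; rewrite -!v_eq0 l1 l1' oner_eq0. Qed.

Lemma unit_region_1sub l : unit_region v l -> unit_region v (1 - l).
Proof. by move=> [l1 l1']; split=> //; rewrite opprB addrC subrK. Qed.

Lemma unit_region_inv l : unit_region v l -> unit_region v l^-1.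
Proof.
move=> lU; have [l0 l0'] := unit_region_neq lU; case: lU => l1 l1'.
split; first by rewrite vV l1 invr1.
have -> : 1 - l^-1 = - (1 - l) / l by field.
by rewrite vM vN vV l1 l1' divr1.
Qed.

Lemma v_inv_sub x y : v x = 1 -> v (y - x) < 1 -> v (y^-1 - x^-1) < 1.
Proof.
move=> x1 yx; have y1 := v_close yx x1.
have nz z : v z = 1 -> z != 0 by move=> z1; rewrite -v_eq0 z1 oner_eq0.
have -> : y^-1 - x^-1 = - (y - x) / (x * y) by field; rewrite !nz.
by rewrite vM vN vV vM x1 y1 mulr1 divr1.
Qed.

(** Maps of the unit region that pass to the residue field and commute there
    with Frobenius. *)
Definition frob_compatible (f : K -> K) : Prop :=
  forall x, unit_region v x ->
    [/\ unit_region v (f x), forall y, v (y - x) < 1 -> v (f y - f x) < 1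
      & v (f x ^+ p - f (x ^+ p)) < 1].

Lemma frob_compatible_1sub f : odd p -> frob_compatible f ->
  frob_compatible (fun x => 1 - f x).
Proof.
move=> p_odd hf x xU; have [fxU near frob] := hf x xU; split.
- exact: unit_region_1sub.
- move=> y /near; have -> : 1 - f y - (1 - f x) = - (f y - f x) by ring.
  by rewrite vN.
apply: v_dist_lt (v_frob_1sub p_odd _) _; first by case: fxU => ->.
have -> : 1 - f x ^+ p - (1 - f (x ^+ p)) = - (f x ^+ p - f (x ^+ p)) by ring.
by rewrite vN.
Qed.

Lemma frob_compatible_inv f : odd p -> frob_compatible f ->
  frob_compatible (fun x => (f x)^-1).
Proof.
move=> p_odd hf x xU; have [fxU near frob] := hf x xU; split.
- exact: unit_region_inv.
- by move=> y /near; apply: v_inv_sub; case: fxU.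
rewrite exprVn; apply: v_inv_sub frob.
by have [[->]] := hf _ (frob_unit_region p_odd xU).
Qed.

Lemma eq_frob_compatible f g : odd p ->
  (forall x, unit_region v x -> f x = g x) ->
  frob_compatible f -> frob_compatible g.
Proof.
move=> p_odd fg hf x xU; have [fxU near frob] := hf x xU.
split; rewrite -?fg //; last exact: frob_unit_region.
by move=> y yx; rewrite -fg ?near //; apply: unit_region_close xU yx.
Qed.

(** The substitutions 1 - l and 1 / l generate the anharmonic group. *)
Lemma anh_frob_compatible t : odd p -> frob_compatible (anh t).
Proof.
move=> p_odd; have sub1 := frob_compatible_1sub p_odd.
have inv := frob_compatible_inv p_odd.
have id_comp : frob_compatible (fun x => x).
  by move=> x xU; split=> //; rewrite subrr v0.
have eqc := eq_frob_compatible p_odd.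
case: t => /=.
- exact: id_comp.
- exact: sub1 id_comp.
- exact: inv id_comp.
- exact: inv (sub1 _ id_comp).
- apply: eqc (sub1 _ (inv _ (sub1 _ id_comp))) => x /unit_region_neq[x0 x1] /=.
  by field; rewrite x1 -opprB oppr_eq0 x1.
- apply: eqc (sub1 _ (inv _ id_comp)) => x /unit_region_neq[x0 x1] /=.
  by field.
Qed.

(** * Change of the Frobenius lifting *)

(** The law of solution matrices between y and l ^+ p carries the identity for the
    standard lifting to y; for the parameters M(b) the two solution matrices
    compose because theta(l) ^+ p, theta(l ^+ p) and theta(y) lie in one residue
    disk. *)
Lemma H_intertwines_lift (pi : K) (D : kummer_datum) (a b : 'rV[K]_3) l y :
  let M := mapply (kd_M D) in
  let theta := anh (kd_theta D) in
  let gam := frobenius2 p v pi in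
  odd p ->
  (forall c, generic v c -> forall z, unit_region v z ->
     exists Y, solution_matrix v c z Y) ->
  is_kummer p v pi D ->
  generic v a -> generic v b -> generic v (M a) -> generic v (M b) ->
  (forall i, isint (p%:R * b 0 i - a 0 i)) ->
  unit_region v l -> v (y - l ^+ p) < 1 ->
  H_intertwines p v D a b l y (gam (M a) (M b) (theta l) (theta y)) (gam a b l y).
Proof.
move=> M theta gam p_odd ex [_ K1 K2] a_gen b_gen Ma_gen Mb_gen ab_int lU yl.
have [bz _ _ _] := b_gen; have [Mbz _ _ _] := Mb_gen.
have wU := frob_unit_region p_odd lU; set w := l ^+ p in yl wU.
have yU := unit_region_close wU yl.
have wy : v (w - y) < 1 by rewrite v_sub.
have := K1 b b_gen Mb_gen y w yU wy.
have := K2 a b a_gen b_gen Ma_gen Mb_gen ab_int l lU.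
rewrite /H_intertwines /gam /frobenius2 -/theta -/M -/w.
have [tlU _ tfrob] := anh_frob_compatible (kd_theta D) p_odd lU.
have [twU tnear _] := anh_frob_compatible (kd_theta D) p_odd wU.
have [tyU tnear' _] := anh_frob_compatible (kd_theta D) p_odd yU.
rewrite -/theta -/w in tlU tfrob twU tnear tyU tnear'.
rewrite (Csol_centre (ex b b_gen) wU) trmx1 mulmx1.
rewrite (Csol_mul Mbz (ex _ Mb_gen) tyU (tnear' _ wy) tfrob).
set A := frobenius _ _ _ _ _ _; set B := frobenius _ _ _ _ _ _.
move=> k2 /(congr1 trmx); rewrite linearZ /= !trmx_mul !trmxK => k1.
rewrite -[RHS]mulmxA -k1 -scalemxAr [X in _ = _ *: X]mulmxA -k2 -scalemxAl scalerA.
rewrite !mulmxA; congr (_ *: _).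
have [[w1 w1'] [l1 l1']] := (wU, lU).
have [[y0 y0'] [w0 w0']] := (unit_region_neq yU, unit_region_neq wU).
rewrite /hratio /hquot.
have q1 : v ((1 - l) ^+ p) = 1 by rewrite vX l1' expr1n.
rewrite -(binpow_change (Zp_aeval (kd_r D) bz) w1 w1 yl) ?subrr ?v0 //.
have wq : v (1 - w - (1 - l) ^+ p) < 1 by rewrite v_sub v_frob_1sub ?l1.
have yl' : v (1 - y - (1 - w)) < 1.
  by have -> : 1 - y - (1 - w) = w - y by ring.
rewrite -(binpow_change (Zp_aeval (kd_s D) bz) w1' q1 yl' wq).
have comm (t r s b1 b2 b3 b4 : K) :
  t * r * (b1 * b3) * s * (b2 * b4) = b1 * b2 * (t * r * b3 * s * b4) by ring.
exact: comm.
Qed.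
End PadicAbs.

(** * The identity theorem for Krasner analytic functions *)

Section IdentityTheorem.
Context {R : realType} {K : closedFieldType} {p : nat} {v : K -> R}.
Context (v_padic : padic_abs p v).

(** A root w of the product of X and the X - u, minus 1: if w had absolute value
    above 1 all factors would, and otherwise all are at most 1 with product 1. *)
Lemma unit_avoiding (us : seq K) : (forall u, u \in us -> v u <= 1) ->
  exists2 w, v w = 1 & forall u, u \in us -> v (w - u) = 1.
Proof.
move=> us1; pose P := \prod_(u <- 0 :: us) ('X - u%:P).
have sP : size P = (size us).+2 by rewrite size_prod_XsubC.
have [|w] := closed_rootP (P - 1) _.
  by rewrite size_polyDl ?sP // size_polyN size_poly1.
rewrite /root hornerD hornerN hornerC subr_eq0 horner_prod => /eqP /(congr1 v).
under eq_bigr do rewrite hornerXsubC.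
rewrite (v1 v_padic) (v_prod v_padic) => prod1.
have w1 : v w <= 1.
  rewrite leNgt; apply/negP => w_gt1; suff : 1 < \prod_(u <- 0 :: us) v (w - u).
    by rewrite prod1 ltxx.
  rewrite big_cons subr0; apply: (lt_le_trans w_gt1).
  rewrite ler_peMr ?(v_ge0 v_padic) //.
  rewrite big_seq; apply: (big_ind (fun t => 1 <= t)) => // [s t|u /us1 u1].
    exact: mulr_ege1.
  have uw : v (- u) < v w by rewrite (vN v_padic) (le_lt_trans u1).
  by rewrite addrC (vD_max v_padic) // ltW.
have us1' u : u \in 0 :: us -> v (w - u) <= 1.
  rewrite inE => /orP[/eqP->|/us1 u1]; first by rewrite subr0.
  exact: (vB_le v_padic).
have all1 u : u \in 0 :: us -> v (w - u) = 1.
  move=> us_u; apply/eqP; rewrite eq_le us1' //= -[leLHS]prod1 (big_rem u) //=.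
  rewrite ler_piMr ?(v_ge0 v_padic) // big_seq.
  apply: Num.Theory.prodr_ile1 => z rem_z; rewrite (v_ge0 v_padic) /=.
  by apply: us1'; apply: (@mem_rem _ u); apply: rem_z.
exists w; first by have := all1 0 (mem_head _ _); rewrite subr0.
by move=> u us_u; apply: all1; rewrite inE us_u orbT.
Qed.

Lemma generic_on_circle c e (cs : seq K) : e != 0 ->
  exists y, forall z, z \in c :: cs -> v (y - z) = Num.max (v e) (v (z - c)).
Proof.
move=> e0; have ve0 : 0 < v e by rewrite (v_gt0 v_padic).
pose us := [seq (z - c) / e | z <- [seq z <- c :: cs | v (z - c) <= v e]].
have [u /mapP[z]|w w1 hw] := @unit_avoiding us.
  rewrite mem_filter => /andP[ze _] ->.
  by rewrite (vM v_padic) (vV v_padic) ler_pdivrMr // mul1r.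
exists (c + e * w) => z cs_z; have [ze|ez] := leP (v (z - c)) (v e).
  have -> : c + e * w - z = e * (w - (z - c) / e) by field.
  rewrite (vM v_padic) hw ?mulr1 //; apply: (map_f (fun z => (z - c) / e)).
  by rewrite mem_filter ze.
have -> : c + e * w - z = e * w - (z - c) by ring.
by rewrite (vD_max v_padic) ?(vN v_padic) // (vM v_padic) w1 mulr1.
Qed.

Lemma v_horner (P : {poly K}) : exists rs : seq K,
  (forall x, v P.[x] = v (lead_coef P) * \prod_(z <- rs) v (x - z)) /\
  forall z, z \in rs -> P.[z] = 0.
Proof.
have [rs defP] := closed_field_poly_normal P.
have vP x : v P.[x] = v (lead_coef P) * \prod_(z <- rs) v (x - z).
  rewrite {1}defP hornerZ horner_prod (vM v_padic) (v_prod v_padic).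
  by under eq_bigr do rewrite hornerXsubC.
exists rs; split=> // z rs_z; apply/eqP.
by rewrite -(v_eq0 v_padic) vP (big_rem z) //= subrr (v0 v_padic) mul0r mulr0.
Qed.

(** In logarithmic coordinates: max(t, log A) is a convex function of t, here
    between t = 0 and t = log rho at the point t = log r that divides this
    interval in the ratio k : 1. *)
Lemma max_convex (r rho A : R) k : 0 < r -> 0 < rho -> 0 <= A ->
  rho ^+ k = r ^+ k.+1 ->
  Num.max r A ^+ k.+1 <= Num.max 1 A * Num.max rho A ^+ k.
Proof.
move=> r0 rho0 A0 rhor.
have [Ar|rA] := leP A r; last first.
  rewrite exprS ler_pM ?exprn_ge0 ?le_max ?lexx ?orbT //.
  by rewrite lerXn2r ?nnegrE ?le_max ?lexx ?A0 ?orbT.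
rewrite -rhor -[leLHS]mul1r ler_pM ?exprn_ge0 ?ler01 ?le_max ?lexx ?(ltW rho0) //.
by rewrite lerXn2r ?nnegrE ?le_max ?(ltW rho0) ?lexx.
Qed.

(** Away from its break point the same function is affine. *)
Lemma max_affine (r rho A : R) k : r != 1 -> (0 < k)%N -> 0 < r -> 0 < rho ->
  0 <= A -> rho ^+ k = r ^+ k.+1 ->
  A <= Num.min 1 rho \/ Num.max 1 rho <= A ->
  A != r /\ Num.max 1 A * Num.max rho A ^+ k = Num.max r A ^+ k.+1.
Proof.
move=> rn1 k0 r0 rho0 A0 rhor.
have rk0 : 0 < r ^+ k by rewrite exprn_gt0.
have monoX x y : 0 < x -> 0 < y -> x ^+ k < y ^+ k -> x < y.
  by move=> x0 y0; rewrite ltr_pXn2r ?nnegrE ?ltW.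
have small : A < r -> A <= 1 -> A <= rho ->
    A != r /\ Num.max 1 A * Num.max rho A ^+ k = Num.max r A ^+ k.+1.
  by move=> Ar A1 Arho; rewrite lt_eqF // !max_l ?(ltW Ar) // mul1r.
have large : r < A -> 1 <= A -> rho <= A ->
    A != r /\ Num.max 1 A * Num.max rho A ^+ k = Num.max r A ^+ k.+1.
  by move=> rA A1 rhoA; rewrite gt_eqF // !max_r ?(ltW rA) // exprS.
rewrite le_min ge_max; case: (ltgtP r 1) rn1 => // [r1|r1] _.
  have rho_r : rho < r by apply: monoX; rewrite // rhor exprS gtr_pMl.
  by case=> /andP[A1 Arho]; [apply: small|apply: large] => //;
    [apply: le_lt_trans rho_r|apply: lt_le_trans A1].
have r_rho : r < rho by apply: monoX; rewrite // rhor exprS ltr_pMl.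
by case=> /andP[A1 Arho]; [apply: small|apply: large] => //;
  [apply: le_lt_trans r1|apply: lt_le_trans Arho].
Qed.

Lemma prod_le_weighted (I : eqType) (s : seq I) (f g h : I -> R) (a : R) k :
  0 <= a ->
  (forall i, i \in s -> 0 <= f i /\ f i ^+ k.+1 <= g i * h i ^+ k) ->
  (a * \prod_(i <- s) f i) ^+ k.+1 <=
    (a * \prod_(i <- s) g i) * (a * \prod_(i <- s) h i) ^+ k.
Proof.
move=> a0 hs; rewrite !exprMn mulrACA -exprS ler_wpM2l ?exprn_ge0 //.
rewrite -!prodrXl -big_split /= big_seq [leRHS]big_seq.
apply: ler_prod => i /hs[f0 ->].
by rewrite exprn_ge0.
Qed.

Lemma polynomial_three_circles (P : {poly K}) (rs : seq K) (c x0 y1 e ye : K) k :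
  (forall x, v P.[x] = v (lead_coef P) * \prod_(z <- rs) v (x - z)) ->
  e != 0 -> x0 != c -> v e ^+ k = v (x0 - c) ^+ k.+1 ->
  (forall z, z \in rs -> v (y1 - z) = Num.max 1 (v (z - c))) ->
  (forall z, z \in rs -> v (ye - z) = Num.max (v e) (v (z - c))) ->
  v P.[x0] ^+ k.+1 <= v P.[y1] * v P.[ye] ^+ k.
Proof.
move=> vP e0 x0c ek hy1 hye; rewrite !vP; apply: prod_le_weighted => [|z rs_z].
  exact: (v_ge0 v_padic).
rewrite !(v_ge0 v_padic); split=> //; rewrite hy1 // hye //.
have ve0 : 0 < v e by rewrite (v_gt0 v_padic).
have r0 : 0 < v (x0 - c) by rewrite (v_gt0 v_padic) subr_eq0.
apply: le_trans (max_convex r0 ve0 (v_ge0 v_padic _) ek).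
have max0 : 0 <= Num.max (v (x0 - c)) (v (z - c)) by rewrite le_max (v_ge0 v_padic).
rewrite lerXn2r ?nnegrE ?(v_ge0 v_padic) //.
have -> : x0 - z = (x0 - c) - (z - c) by ring.
by apply: (vB_le v_padic); rewrite le_max lexx ?orbT.
Qed.

Lemma polynomial_no_roots_between (P : {poly K}) (rs : seq K) (c x0 y1 e ye : K) k :
  (forall x, v P.[x] = v (lead_coef P) * \prod_(z <- rs) v (x - z)) ->
  e != 0 -> x0 != c -> v e ^+ k = v (x0 - c) ^+ k.+1 -> (0 < k)%N ->
  v (x0 - c) != 1 ->
  (forall z, z \in rs ->
     v (z - c) <= Num.min 1 (v e) \/ Num.max 1 (v e) <= v (z - c)) ->
  (forall z, z \in rs -> v (y1 - z) = Num.max 1 (v (z - c))) ->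
  (forall z, z \in rs -> v (ye - z) = Num.max (v e) (v (z - c))) ->
  v P.[x0] ^+ k.+1 = v P.[y1] * v P.[ye] ^+ k.
Proof.
move=> vP e0 x0c ek k0 rn1 hout hy1 hye; rewrite !vP !exprMn mulrACA -exprS.
congr (_ * _); rewrite -!prodrXl -big_split /= big_seq [RHS]big_seq.
apply: eq_bigr => z rs_z; rewrite hy1 // hye //.
have ve0 : 0 < v e by rewrite (v_gt0 v_padic).
have r0 : 0 < v (x0 - c) by rewrite (v_gt0 v_padic) subr_eq0.
have [zr ->] := max_affine rn1 k0 r0 ve0 (v_ge0 v_padic _) ek (hout z rs_z).
have -> : x0 - z = (x0 - c) - (z - c) by ring.
have [lt|gt|eq] := ltgtP (v (z - c)) (v (x0 - c)).
- by rewrite addrC (vD_max v_padic) ?(vN v_padic).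
- by rewrite (vD_max v_padic) ?(vN v_padic).
- by rewrite eq eqxx in zr.
Qed.

(** A Hadamard three-circles estimate: a rational function g close to F is small
    at a point of the unit region, bounded on the circle of radius v e around c
    independently of g, and has no poles in the annulus between the two; so it is
    small at x0, which lies in this annulus. *)
Lemma analytic_eq0_annulus (S : set K) (F : K -> K) (c x0 e : K) k :
  analytic_on v S F -> unit_region v `<=` S ->
  (forall x, unit_region v x -> F x = 0) ->
  v c <= 1 -> v (1 - c) <= 1 -> S x0 -> x0 != c -> v (x0 - c) != 1 ->
  (0 < k)%N -> e != 0 -> v e ^+ k = v (x0 - c) ^+ k.+1 ->
  (forall y, v (y - c) = v e \/ Num.min 1 (v e) < v (y - c) < Num.max 1 (v e) ->
     S y) ->
  F x0 = 0.
Proof.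
move=> Fan US F0 c1 c1' Sx0 x0c rn1 k0 e0 ek Sann.
have vx := v_ge0 v_padic.
(* one fixed approximant bounds all others on generic points of the circle, where
   its absolute value N1 / N2 does not depend on the point *)
have [P1 [Q1 h1]] := Fan 1 ltr01.
have [rs1 [vP1 _]] := v_horner P1; have [ss1 [vQ1 _]] := v_horner Q1.
pose N1 := v (lead_coef P1) * \prod_(z <- rs1) Num.max (v e) (v (z - c)).
pose N2 := v (lead_coef Q1) * \prod_(z <- ss1) Num.max (v e) (v (z - c)).
pose B := Num.max 1 (N1 / N2).
have B1 : 1 <= B by rewrite le_max lexx.
have B0 : 0 < B by apply: lt_le_trans B1.
apply/eqP; apply: contraT; rewrite -(v_gt0 v_padic) => f0.
(* an approximation so good that the three-circles inequality fails unless
   F x0 = 0 *)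
pose d := Num.min 1 (Num.min (v (F x0)) (v (F x0) ^+ k.+1 / B ^+ k)).
have d0 : 0 < d by rewrite !lt_min ltr01 f0 divr_gt0 ?exprn_gt0.
have [P [Q h]] := Fan d d0.
have [rs [vP rsP]] := v_horner P; have [ss [vQ ssQ]] := v_horner Q.
have [y1] := generic_on_circle c (0 :: 1 :: rs ++ ss) (oner_neq0 _).
rewrite (v1 v_padic) => hy1.
have [ye hye] := generic_on_circle c (rs ++ ss ++ rs1 ++ ss1) e0.
have y1U : unit_region v y1.
  split; first by rewrite -[y1]subr0 hy1 ?inE ?eqxx ?orbT // sub0r (vN v_padic) max_l.
  by rewrite (v_sub v_padic) hy1 ?inE ?eqxx ?orbT // max_l.
have yeS : S ye.
  by apply: Sann; left; rewrite hye ?inE ?eqxx // subrr (v0 v_padic) max_l.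
have Py1 z : z \in rs -> v (y1 - z) = Num.max 1 (v (z - c)).
  by move=> rz; rewrite hy1 // !inE mem_cat rz !orbT.
have Qy1 z : z \in ss -> v (y1 - z) = Num.max 1 (v (z - c)).
  by move=> rz; rewrite hy1 // !inE mem_cat rz !orbT.
have Pye z : z \in rs -> v (ye - z) = Num.max (v e) (v (z - c)).
  by move=> rz; rewrite hye // !inE !mem_cat rz !orbT.
have Qye z : z \in ss -> v (ye - z) = Num.max (v e) (v (z - c)).
  by move=> rz; rewrite hye // !inE !mem_cat rz !orbT.
have Qout z : z \in ss ->
    v (z - c) <= Num.min 1 (v e) \/ Num.max 1 (v e) <= v (z - c).
  move=> sz; have [zl|zl] := leP (v (z - c)) (Num.min 1 (v e)); first by left.
  have [zu|zu] := leP (Num.max 1 (v e)) (v (z - c)); first by right.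
  have [] := h z (Sann z (or_intror _)); first by rewrite zl zu.
  by rewrite ssQ ?eqxx.
have hP := polynomial_three_circles vP e0 x0c ek Py1 Pye.
have hQ := polynomial_no_roots_between vQ e0 x0c ek k0 rn1 Qout Qy1 Qye.
pose g x := P.[x] / Q.[x].
have Qn x : S x -> 0 < v Q.[x] by move=> /h[]; rewrite (v_gt0 v_padic).
have three : v (g x0) ^+ k.+1 <= v (g y1) * v (g ye) ^+ k.
  rewrite /g !(vM v_padic) !(vV v_padic) !exprMn !exprVn mulrACA -invfM -hQ.
  by rewrite ler_wpM2r ?invr_ge0 ?exprn_ge0.
have gy1 : v (g y1) < d.
  by have [_] := h y1 (US _ y1U); rewrite F0 // sub0r (vN v_padic).
have d1 : d <= 1 by rewrite ge_min lexx.
have gye : v (g ye) <= B.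
  have g1 : v (P1.[ye] / Q1.[ye]) <= B.
    rewrite (vM v_padic) (vV v_padic) vP1 vQ1 le_max; apply/orP; right.
    have E s : {subset s <= rs ++ ss ++ rs1 ++ ss1} ->
        \prod_(z <- s) v (ye - z) = \prod_(z <- s) Num.max (v e) (v (z - c)).
      move=> sub; rewrite big_seq [RHS]big_seq; apply: eq_bigr => z /sub sz.
      by rewrite hye // inE sz orbT.
    by rewrite !E // => z sz; rewrite !mem_cat sz !orbT.
  rewrite -(subrK (P1.[ye] / Q1.[ye]) (g ye)); apply: (vD_le v_padic) => //.
  apply: (v_dist_le v_padic (y := F ye)).
    by rewrite (v_sub v_padic); apply: ltW (lt_le_trans (h ye yeS).2 (le_trans d1 B1)).
  exact: ltW (lt_le_trans (h1 ye yeS).2 B1).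
have gx0 : v (F x0) = v (g x0).
  apply/esym; apply: (v_close v_padic (e := v (F x0))) => //.
  rewrite (v_sub v_padic); apply: lt_le_trans (h x0 Sx0).2 _.
  by rewrite !ge_min lexx !orbT.
have: v (F x0) ^+ k.+1 < v (F x0) ^+ k.+1.
  rewrite {1}gx0; apply: le_lt_trans three _.
  apply: le_lt_trans (_ : v (g y1) * B ^+ k < _).
    by rewrite ler_wpM2l // lerXn2r ?nnegrE ?vx // ltW.
  rewrite -ltr_pdivlMr ?exprn_gt0 //; apply: lt_le_trans gy1 _.
  by rewrite !ge_min lexx !orbT.
by rewrite ltxx.
Qed.

Lemma closed_root (x : K) k : (0 < k)%N -> exists y, y ^+ k = x.
Proof.
move=> k0; have [|y] := closed_rootP ('X^k - x%:P) _.
  by rewrite size_XnsubC // eqSS -lt0n.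
by rewrite /root !hornerE subr_eq0 => /eqP <-; exists y.
Qed.

(** The numbers |x| ^ (1 + 1/k) are absolute values because K contains k-th roots;
    they are less than |x| and tend to it as k grows, so they exceed t at last. *)
Lemma intermediate_radius (x : K) (t : R) : x != 0 -> 0 <= t -> t < v x -> v x < 1 ->
  exists k e, [/\ (0 < k)%N, v e ^+ k = v x ^+ k.+1 & t < v e < 1].
Proof.
move=> x0 t0 tx x1; have vx0 : 0 < v x by rewrite (v_gt0 v_padic).
have [|||N /(_ N.+1 (leqnSn N)) hN] := @expr_small _ (t / v x) (v x).
- by rewrite divr_ge0 // ltW.
- by rewrite ltr_pdivrMr // mul1r.
- exact: vx0.
have [e ek] := closed_root (x ^+ N.+2) (ltn0Sn N).
have vek : v e ^+ N.+1 = v x ^+ N.+2 by rewrite -!(vX v_padic) ek.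
exists N.+1, e; split=> //; apply/andP; split;
  rewrite -(@ltr_pXn2r _ N.+1) ?nnegrE ?(v_ge0 v_padic) // vek.
  by move: hN; rewrite expr_div_n ltr_pdivrMr ?exprn_gt0 // -exprS.
by rewrite expr1n exprn_ilt1 ?(v_ge0 v_padic).
Qed.

Lemma unit_region_sub eps : 0 < eps -> unit_region v `<=` eps_region v eps.
Proof.
move=> eps0 x [x1 x1']; rewrite /eps_region /= (vV v_padic) x1 x1' invr1 !lt_min.
by rewrite ltrBlDr ltrDl eps0.
Qed.

(** The eps-region is the union of the unit region and three annuli bordering it,
    around 0, 1 and infinity. *)
Lemma analytic_eq0 (eps : R) (F : K -> K) : 0 < eps -> eps <= 1 ->
  analytic_on v (eps_region v eps) F -> (forall x, unit_region v x -> F x = 0) ->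
  forall x, eps_region v eps x -> F x = 0.
Proof.
move=> eps0 eps1 Fan F0 x Sx.
have t0 : 0 <= 1 - eps by rewrite subr_ge0.
have t1 : 1 - eps < 1 by rewrite ltrBlDr ltrDl.
have vx y := v_ge0 v_padic y.
have US := unit_region_sub eps0.
have inS y : 1 - eps < v y -> 1 - eps < v y^-1 -> 1 - eps < v (1 - y) ->
    eps_region v eps y by rewrite /eps_region /= !lt_min => -> -> ->.
have tV y : 0 < v y -> v y <= 1 -> 1 - eps < v y^-1.
  by move=> y0 y1; rewrite (vV v_padic) (lt_le_trans t1) // invf_ge1.
move: (Sx); rewrite /eps_region /= !lt_min => /and3P[tx txV tx1].
have xgt0 : 0 < v x by apply: le_lt_trans tx.
have xn0 : x != 0 by rewrite -(v_gt0 v_padic).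
have near0 y : v y < 1 -> v (1 - y) = 1.
  by move=> y1; rewrite addrC (vD_max v_padic) ?(vN v_padic) (v1 v_padic).
have near_oo y : 1 < v y -> v (1 - y) = v y.
  by move=> y1; rewrite (vD_max v_padic) ?(vN v_padic) ?(v1 v_padic).
have c01 : v 0 <= 1 /\ v (1 - 0) <= 1 by rewrite subr0 (v0 v_padic) (v1 v_padic).
have c11 : v 1 <= 1 /\ v (1 - 1) <= 1 by rewrite subrr (v0 v_padic) (v1 v_padic).
have [x1|x1|x1] := ltgtP (v x) 1.
- have [k [e [k0 ek /andP[te e1]]]] := intermediate_radius xn0 t0 tx x1.
  have e0 : e != 0 by rewrite -(v_gt0 v_padic) (le_lt_trans t0).
  apply: (analytic_eq0_annulus (c := 0) (e := e) (k := k) Fan US F0);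
    rewrite ?subr0 ?c01.1 ?(v1 v_padic) ?lt_eqF // => y.
  rewrite subr0 (min_r (ltW e1)) (max_l (ltW e1)) => hy.
  have [ty y1] : 1 - eps < v y /\ v y < 1.
    by case: hy => [->|/andP[/(lt_trans te) -> ->]].
  by apply: inS; rewrite ?near0 ?tV ?(le_lt_trans t0 ty) ?(ltW y1).
- have xV1 : v x^-1 < 1 by rewrite (vV v_padic) invf_lt1.
  have [k [e [k0 ek /andP[te e1]]]] :=
    intermediate_radius (invr_neq0 xn0) t0 txV xV1.
  have e0 : e != 0 by rewrite -(v_gt0 v_padic) (le_lt_trans t0).
  have ve0 : 0 < v e by rewrite (v_gt0 v_padic).
  have eV1 : 1 < v e^-1 by rewrite (vV v_padic) invf_gt1.
  apply: (analytic_eq0_annulus (c := 0) (e := e^-1) (k := k) Fan US F0);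
    rewrite ?subr0 ?c01.1 ?(v1 v_padic) ?gt_eqF ?invr_neq0 //.
    by rewrite (vV v_padic) exprVn ek -exprVn -(vV v_padic) invrK.
  move=> y; rewrite subr0 (min_l (ltW eV1)) (max_r (ltW eV1)) => hy.
  have [y1 ye] : 1 < v y /\ v y <= v e^-1.
    by case: hy => [->|/andP[-> /ltW]].
  have y0 : 0 < v y by apply: lt_trans y1.
  apply: inS; rewrite ?near_oo ?(lt_trans t1 y1) //.
  rewrite (vV v_padic) (lt_le_trans te) // -[v e]invrK -(vV v_padic).
  by rewrite lef_pV2 ?posrE ?(lt_trans ltr01 eV1).
have [x1'|x1'] := eqVneq (v (x - 1)) 1.
  by apply: F0; split; rewrite // (v_sub v_padic).
rewrite (v_sub v_padic) in tx1.
have xm1 : v (x - 1) < 1.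
  by rewrite lt_def eq_sym x1' (vB_le v_padic) // ?x1 ?(v1 v_padic).
have x0' : x - 1 != 0 by rewrite -(v_gt0 v_padic) (le_lt_trans t0).
have [k [e [k0 ek /andP[te e1]]]] := intermediate_radius x0' t0 tx1 xm1.
have e0 : e != 0 by rewrite -(v_gt0 v_padic) (le_lt_trans t0).
apply: (analytic_eq0_annulus (c := 1) (e := e) (k := k) Fan US F0);
  rewrite ?c11.1 ?c11.2 -?[x == 1]subr_eq0 // => y.
rewrite (min_r (ltW e1)) (max_l (ltW e1)) => hy.
have [ty y1] : 1 - eps < v (y - 1) /\ v (y - 1) < 1.
  by case: hy => [->|/andP[/(lt_trans te) -> ->]].
have vy : v y = 1 by apply: (v_close v_padic y1); rewrite (v1 v_padic).
by apply: inS; rewrite ?tV ?vy ?ltr01 // (v_sub v_padic).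
Qed.

Lemma analytic_onB (S : set K) (F G : K -> K) :
  analytic_on v S F -> analytic_on v S G -> analytic_on v S (fun x => F x - G x).
Proof.
move=> hF hG e e0; have [P1 [Q1 h1]] := hF e e0; have [P2 [Q2 h2]] := hG e e0.
exists (P1 * Q2 - P2 * Q1), (Q1 * Q2) => x Sx.
have [[q1 b1] [q2 b2]] := (h1 x Sx, h2 x Sx).
rewrite hornerD hornerN !hornerM; split; first by rewrite mulf_neq0.
have -> : F x - G x - (P1.[x] * Q2.[x] - P2.[x] * Q1.[x]) / (Q1.[x] * Q2.[x])
    = (F x - P1.[x] / Q1.[x]) - (G x - P2.[x] / Q2.[x]) by field; rewrite q1 q2.
exact: (vB_lt v_padic).
Qed.

Lemma mx_analytic_eq (eps : R) (F G : K -> 'M[K]_2) : 0 < eps -> eps <= 1 ->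
  mx_analytic_on v (eps_region v eps) F -> mx_analytic_on v (eps_region v eps) G ->
  (forall x, unit_region v x -> F x = G x) ->
  forall x, eps_region v eps x -> F x = G x.
Proof.
move=> eps0 eps1 hF hG FG x Sx; apply/matrixP => i j; apply/eqP.
rewrite -subr_eq0; apply/eqP.
apply: (analytic_eq0 eps0 eps1 (analytic_onB (hF i j) (hG i j)) _ Sx) => y yU.
by rewrite FG ?subrr.
Qed.

End IdentityTheorem.

Theorem mainTheorem3 (R : realType) (K : closedFieldType) (p : nat) (v : K -> R)
    (pi : K) (D : kummer_datum) (a b : 'rV[K]_3) (phi : K -> K)
  (p_prime : prime p) (p_odd : odd p) (v_padic : padic_abs p v)
  (pi_eq : pi ^+ p.-1 = - p%:R)
  (C_converges : forall c : 'rV[K]_3, generic v c ->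
     forall z, unit_region v z -> exists Y, solution_matrix v c z Y)
  (D_kummer : is_kummer p v pi D)
  (a_gen : generic v a) (b_gen : generic v b)
  (Ma_gen : generic v (mapply (kd_M D) a))
  (Mb_gen : generic v (mapply (kd_M D) b))
  (ab_int : forall i, isint (p%:R * b 0 i - a 0 i))
  (phi_analytic : exists2 eps : R, 0 < eps & analytic_on v (eps_region v eps) phi)
  (phi_frob : forall l, unit_region v l -> v (phi l - l ^+ p) < 1) :
  let M := mapply (kd_M D) in
  let theta := anh (kd_theta D) in
  let gam := frobenius2 p v pi in
  (forall l, unit_region v l ->
     H_intertwines p v D a b l (phi l)
       (gam (M a) (M b) (theta l) (theta (phi l))) (gam a b l (phi l))) /\
  (forall (eps : R) (F1 F2 : K -> 'M[K]_2), 0 < eps -> eps <= 1 ->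
     mx_analytic_on v (eps_region v eps) F1 ->
     mx_analytic_on v (eps_region v eps) F2 ->
     (forall l, unit_region v l ->
        F1 l = hquot p v D a b l (phi l)
               *: (kd_N D l *m gam (M a) (M b) (theta l) (theta (phi l)))) ->
     (forall l, unit_region v l -> F2 l = gam a b l (phi l) *m kd_N D (phi l)) ->
     forall l, eps_region v eps l -> F1 l = F2 l).
Proof.
move=> M theta gam.
have intertwines l (lU : unit_region v l) :
    H_intertwines p v D a b l (phi l)
      (gam (M a) (M b) (theta l) (theta (phi l))) (gam a b l (phi l)).
  by apply: (H_intertwines_lift p_prime v_padic) => //; apply: phi_frob.
split=> // eps F1 F2 eps0 eps1 F1an F2an F1E F2E.
apply: (mx_analytic_eq v_padic eps0 eps1 F1an F2an) => l lU.
by rewrite F1E // F2E //; apply: intertwines.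
Qed.
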